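(* Let $k$ be a real constant and let $f(u_1,u_2)$, $f\in\mathcal{S}'(\mathbb{R}^2)$, be a solution of the Helmholtz equation $$\partial_1^2 f+\partial_2^2 f+k^2 f=0 .$$ Then the two-dimensional metamorphism of $f$ has the form $\mathcal{M}f=\mathcal{G}f_4$, where $f_4$ is a function of the form $$f_4(z_1,w_1;z_2,w_2)=\frac{e^{k^2(w_1^{-1}+w_2^{-1})/(8\pi i\hbar)}}{\sqrt{w_1w_2}}\;f_3\left(\frac{1}{w_1}-\frac{1}{w_2},\ \frac{z_1}{w_1},\ \frac{z_2}{w_2}\right)$$ for some holomorphic function $f_3$ of three complex variables which satisfies the two equations $$4\pi i\hbar\,\partial_1 f_3+\partial_{22}^2 f_3+\tfrac12 k^2 f_3=0,$$ $$4\pi i\hbar\,\partial_1 f_3-\partial_{33}^2 f_3-\tfrac12 k^2 f_3=0,$$ where $\partial_j$ applied to $f_3$ denotes the partial derivative with respect to its $j$-th argument.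
   Context: Fix a constant $\hbar>0$. The two-dimensional metamorphism is obtained by applying the one-dimensional metamorphism in each variable: for $f(u_1,u_2)$ on $\mathbb{R}^2$, $\mathcal{M}f$ is the function of $(x_1,y_1,b_1,r_1;x_2,y_2,b_2,r_2)$, with $x_j,y_j,b_j\in\mathbb{R}$ and $r_j>0$, given by $$[\mathcal{M}f](x_1,y_1,b_1,r_1;x_2,y_2,b_2,r_2)=\hbar\sqrt{r_1r_2}\int_{\mathbb{R}^2} f(u_1,u_2)\prod_{j=1}^{2}\exp\left(-\pi\hbar\left((r_j^2-ib_j)(u_j-y_j)^2+2i(u_j-y_j)x_j\right)\right)du_1\,du_2 .$$ For $f\in\mathcal{S}'(\mathbb{R}^2)$ the integral is understood as the (bilinear) pairing of $f$ with the integral kernel, which is a Schwartz function of $(u_1,u_2)$; derivatives of $f$ are distributional. For a holomorphic function $f_4(z_1,w_1;z_2,w_2)$, with $z_j\in\mathbb{C}$ and $\operatorname{Im}w_j>0$, the function $\mathcal{G}f_4$ is $$[\mathcal{G}f_4](x_1,y_1,b_1,r_1;x_2,y_2,b_2,r_2)=\sqrt{r_1r_2}\;e^{-\pi i\hbar(x_1^2/w_1+x_2^2/w_2)}\,f_4(z_1,w_1;z_2,w_2),$$ where $w_j=b_j+ir_j^2$ and $z_j=x_j+(b_j+ir_j^2)y_j=x_j+w_jy_j$ for $j=1,2$. The square root $\sqrt{w_1w_2}$ denotes a fixed holomorphic branch on $\{\operatorname{Im}w_1>0,\ \operatorname{Im}w_2>0\}$ (for instance $\sqrt{w_1}\sqrt{w_2}$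 with principal branches). The three arguments of $f_3$ range over $\mathbb{C}^3$. *)

(* Defs.v *)
From Stdlib Require Import Reals.
From Coquelicot Require Export Coquelicot.
Open Scope R_scope.
Open Scope C_scope.

Definition Cexp (z : C) : C :=
  ((exp (Re z) * cos (Im z))%R, (exp (Re z) * sin (Im z))%R).

(* [cpartial m n phi] is d^(m+n) phi / du1^m du2^n of a complex-valued function
   of two real variables, taken on real and imaginary parts. *)
Definition cpartial (m n : nat) (phi : R -> R -> C) : R -> R -> C :=
  fun u1 u2 =>
    (partial_derive m n (fun s t => Re (phi s t)) u1 u2,
     partial_derive m n (fun s t => Im (phi s t)) u1 u2).

(* [ex_diff_n g n u1 u2] for all n and all points: all iterated partial
   derivatives, in every order, exist and are jointly continuous. *)
Definition smooth (phi : R -> R -> C) : Prop :=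
  forall (n : nat) (u1 u2 : R),
    ex_diff_n (fun s t => Re (phi s t)) n u1 u2 /\
    ex_diff_n (fun s t => Im (phi s t)) n u1 u2.

(* The Schwartz seminorm sup |u1^a u2^b d1^m d2^n phi| is at most B. *)
Definition seminorm_le (a b m n : nat) (phi : R -> R -> C) (B : R) : Prop :=
  forall u1 u2 : R, (Rabs (u1 ^ a * u2 ^ b) * Cmod (cpartial m n phi u1 u2) <= B)%R.

Definition schwartz (phi : R -> R -> C) : Prop :=
  smooth phi /\ forall a b m n : nat, exists B : R, seminorm_le a b m n phi B.

(* A tempered distribution is represented by a functional on all functions
   R^2 -> C, of which only the values on Schwartz functions are meaningful: it
   is C-linear on S(R^2) and continuous, at every point, for the topology given
   by the Schwartz seminorms. *)
Definition tempered (T : (R -> R -> C) -> C) : Prop :=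
  (forall phi psi, schwartz phi -> schwartz psi ->
     T (fun u1 u2 => phi u1 u2 + psi u1 u2) = T phi + T psi) /\
  (forall (c : C) phi, schwartz phi ->
     T (fun u1 u2 => c * phi u1 u2) = c * T phi) /\
  (forall phi, schwartz phi -> forall eps : posreal,
     exists (N : nat) (delta : posreal), forall psi, schwartz psi ->
       (forall a b m n : nat, (a <= N)%nat -> (b <= N)%nat ->
          (m <= N)%nat -> (n <= N)%nat ->
          seminorm_le a b m n (fun u1 u2 => psi u1 u2 - phi u1 u2) delta) ->
       (Cmod (T psi - T phi) < eps)%R).

Definition dist_d1 (T : (R -> R -> C) -> C) : (R -> R -> C) -> C :=
  fun phi => - T (cpartial 1 0 phi).

Definition dist_d2 (T : (R -> R -> C) -> C) : (R -> R -> C) -> C :=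
  fun phi => - T (cpartial 0 1 phi).

(* d1^2 T + d2^2 T + k^2 T = 0 in S'(R^2). *)
Definition helmholtz (k : R) (T : (R -> R -> C) -> C) : Prop :=
  forall phi, schwartz phi ->
    dist_d1 (dist_d1 T) phi + dist_d2 (dist_d2 T) phi + RtoC (k ^ 2) * T phi = 0.

Definition meta_kernel (hbar x y b r u : R) : C :=
  Cexp (- RtoC (PI * hbar) *
        ((RtoC (r ^ 2) - Ci * RtoC b) * RtoC ((u - y) ^ 2)
         + 2 * Ci * RtoC (u - y) * RtoC x)).

Definition metamorphism (hbar : R) (T : (R -> R -> C) -> C)
    (x1 y1 b1 r1 x2 y2 b2 r2 : R) : C :=
  RtoC (hbar * sqrt (r1 * r2)) *
  T (fun u1 u2 => meta_kernel hbar x1 y1 b1 r1 u1 * meta_kernel hbar x2 y2 b2 r2 u2).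

Definition C2 : NormedModule C_AbsRing :=
  prod_NormedModule C_AbsRing C_NormedModule C_NormedModule.
Definition C3 : NormedModule C_AbsRing :=
  prod_NormedModule C_AbsRing C2 C_NormedModule.
Definition C4 : NormedModule C_AbsRing :=
  prod_NormedModule C_AbsRing C3 C_NormedModule.

(* Complex (Frechet) differentiability at every point of D; every D used below
   is open. *)
Definition holomorphic_on {U : NormedModule C_AbsRing} (D : U -> Prop) (g : U -> C)
    : Prop :=
  forall p : U, D p ->
    ex_filterdiff (K := C_AbsRing) (U := U) (V := C_NormedModule) g (locally p).

Definition upper2 (p : C2) : Prop :=
  let '(w1, w2) := p in (0 < Im w1)%R /\ (0 < Im w2)%R.

(* Points are (z1, w1, z2, w2). *)
Definition upper4 (p : C4) : Prop :=
  let '(z1, w1, z2, w2) := p in (0 < Im w1)%R /\ (0 < Im w2)%R.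

Definition sqrt_branch (sq : C2 -> C) : Prop :=
  holomorphic_on upper2 sq /\
  forall w1 w2 : C, upper2 (w1, w2) -> sq (w1, w2) * sq (w1, w2) = w1 * w2.

Definition calG (hbar : R) (f4 : C4 -> C) (x1 y1 b1 r1 x2 y2 b2 r2 : R) : C :=
  let w1 := RtoC b1 + Ci * RtoC (r1 ^ 2) in
  let w2 := RtoC b2 + Ci * RtoC (r2 ^ 2) in
  let z1 := RtoC x1 + w1 * RtoC y1 in
  let z2 := RtoC x2 + w2 * RtoC y2 in
  RtoC (sqrt (r1 * r2)) *
  Cexp (- (RtoC PI * Ci * RtoC hbar) * (RtoC (x1 ^ 2) / w1 + RtoC (x2 ^ 2) / w2)) *
  f4 (z1, w1, z2, w2).

(* [C_derive] takes the limit of the difference quotient along real increments,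
   which is the complex derivative when g is holomorphic. *)
Definition cd1 (g : C3 -> C) : C3 -> C :=
  fun p => let '(s, p2, p3) := p in C_derive (fun t => g (t, p2, p3)) s.
Definition cd2 (g : C3 -> C) : C3 -> C :=
  fun p => let '(p1, s, p3) := p in C_derive (fun t => g (p1, t, p3)) s.
Definition cd3 (g : C3 -> C) : C3 -> C :=
  fun p => let '(p1, p2, s) := p in C_derive (fun t => g (p1, p2, t)) s.

(* Main.v *)
Require Import Defs.
From Stdlib Require Import Reals Lra Lia FunctionalExtensionality.
From Coquelicot Require Import Coquelicot.
Open Scope R_scope.
Open Scope C_scope.

(** Write alpha = pi i hbar.  Completing the square in the kernel
    ([meta_kernel_eq]) turns the metamorphism into [calG] applied to
    [f4 = hbar H(w1, z1/w1; w2, z2/w2)], where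
    [H(w1, t1; w2, t2) = T(exp(alpha (w1 (u1 - t1)^2 + w2 (u2 - t2)^2)))] is the
    pairing of the distribution with a Gaussian of complex width and centre.

    Put tau_j = 1/w_j, a point of the lower half-plane.  The function
    tau^(-1/2) exp(alpha (u - t)^2 / tau) satisfies the heat equation
    d_t^2 = -4 alpha d_tau, so F = sqrt(w1 w2) hbar H satisfies it in each pair
    (tau_j, t_j).  Since the Gaussian depends on u_j - t_j only, the Helmholtz
    equation for the distribution becomes the Helmholtz equation for F in
    (t1, t2) ([pairing_helmholtz]).  Adding the two heat equations gives
    4 alpha (d_tau1 + d_tau2) F = k^2 F.  Hence, after division by
    exp(k^2 (tau1 + tau2) / (8 alpha)), F depends on tau1 and tau2 only through
    s = tau1 - tau2 ([wave_cder_m], [wave_indep]); the resulting function of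
    (s, t1, t2) is f3.  Every complex s is a difference of two points of the
    lower half-plane, so f3 is entire, and the two heat equations for F,
    rewritten for f3, are the two stated equations ([meta_f3_pde]).

    The analytic point is that H is complex differentiable and may be
    differentiated inside the pairing ([pairing_taylor], [pairing_cdiff]).  A
    tempered distribution is bounded by finitely many Schwartz seminorms
    ([tempered_bound]).  The seminorms of the first-order Taylor remainder of
    polynomial times Gaussian are O(|d|^2) in the increment d of the parameters,
    because parameter derivatives commute with derivatives in u and all
    polynomial-times-Gaussian expressions are bounded uniformly for parameters
    in a bounded set with Im w_j bounded below ([gauss_val_bound]). *)

(** * Complex-valued functions of a real variable *)

Lemma C_eq (a b : C) : Re a = Re b -> Im a = Im b -> a = b.
Proof. destruct a, b; simpl; intros; subst; reflexivity. Qed.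

(** The real derivative of a complex-valued function, componentwise,
    which is how the derivatives of a test function are taken. *)
Definition rderive (g : R -> C) (s : R) (l : C) : Prop :=
  is_derive (fun t => Re (g t)) s (Re l) /\ is_derive (fun t => Im (g t)) s (Im l).

Lemma rderive_eq g s l l' : rderive g s l -> l = l' -> rderive g s l'.
Proof. intros H <-; exact H. Qed.

Lemma rderive_const c s : rderive (fun _ => c) s 0.
Proof. split; apply (is_derive_const (V := R_NormedModule)). Qed.

Lemma rderive_plus g h s l m :
  rderive g s l -> rderive h s m -> rderive (fun t => g t + h t) s (l + m).
Proof.
  intros [H1 H2] [H3 H4]; split.
  - apply (is_derive_plus (fun t => Re (g t)) (fun t => Re (h t))); assumption.
  - apply (is_derive_plus (fun t => Im (g t)) (fun t => Im (h t))); assumption.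
Qed.

Lemma is_derive_mulR (a b : R -> R) s l m :
  is_derive a s l -> is_derive b s m ->
  is_derive (fun t => a t * b t)%R s (l * b s + a s * m)%R.
Proof. intros H1 H2; apply (is_derive_mult a b s l m H1 H2); intros; apply Rmult_comm. Qed.

Lemma is_derive_eqR (a : R -> R) (s l l' : R) : is_derive a s l -> l = l' -> is_derive a s l'.
Proof. intros H <-; exact H. Qed.

Lemma rderive_mult g h s l m :
  rderive g s l -> rderive h s m -> rderive (fun t => g t * h t) s (l * h s + g s * m).
Proof.
  intros [H1 H2] [H3 H4].
  split.
  - eapply is_derive_eqR.
    + apply (is_derive_minus (fun t => Re (g t) * Re (h t))%R (fun t => Im (g t) * Im (h t))%R);
        apply is_derive_mulR; eassumption.
    + unfold minus, plus, opp; simpl; unfold Re, Im; ring.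
  - eapply is_derive_eqR.
    + apply (is_derive_plus (fun t => Re (g t) * Im (h t))%R (fun t => Im (g t) * Re (h t))%R);
        apply is_derive_mulR; eassumption.
    + unfold minus, plus, opp; simpl; unfold Re, Im; ring.
Qed.

Lemma rderive_Cexp g s l :
  rderive g s l -> rderive (fun t => Cexp (g t)) s (l * Cexp (g s)).
Proof.
  intros [H1 H2].
  assert (He : is_derive (fun t => exp (Re (g t))) s (Re l * exp (Re (g s)))%R).
  { apply (is_derive_comp exp (fun t => Re (g t))); [apply is_derive_exp|exact H1]. }
  split.
  - eapply is_derive_eqR.
    + apply (is_derive_mulR (fun t => exp (Re (g t))) (fun t => cos (Im (g t)))); [exact He|].
      apply (is_derive_comp cos (fun t => Im (g t))); [apply is_derive_cos|exact H2].
    + unfold scal; simpl; unfold mult; simpl; unfold Re, Im; ring.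
  - eapply is_derive_eqR.
    + apply (is_derive_mulR (fun t => exp (Re (g t))) (fun t => sin (Im (g t)))); [exact He|].
      apply (is_derive_comp sin (fun t => Im (g t))); [apply is_derive_sin|exact H2].
    + unfold scal; simpl; unfold mult; simpl; unfold Re, Im; ring.
Qed.

Lemma rderive_unique g s l m : rderive g s l -> rderive g s m -> l = m.
Proof.
  intros [H1 H2] [H3 H4].
  apply is_derive_unique in H1; apply is_derive_unique in H2.
  apply is_derive_unique in H3; apply is_derive_unique in H4.
  apply C_eq; congruence.
Qed.

Lemma rderive_ext g h s l : (forall t, g t = h t) -> rderive g s l -> rderive h s l.
Proof.
  intros E [H1 H2]; split.
  - apply (is_derive_ext (fun t => Re (g t))); [intros; now rewrite E|exact H1].
  - apply (is_derive_ext (fun t => Im (g t))); [intros; now rewrite E|exact H2].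
Qed.

Lemma rderive_affine a b s : rderive (fun t => a + RtoC t * b) s b.
Proof.
  destruct a as [a1 a2], b as [b1 b2]; split; unfold Re, Im; simpl; auto_derive; trivial; simpl; ring.
Qed.

Lemma Cexp_plus a b : Cexp (a + b) = Cexp a * Cexp b.
Proof.
  unfold Cexp; apply C_eq; unfold Re, Im; cbn [fst snd Cplus Cmult]; rewrite exp_plus; [rewrite cos_plus|rewrite sin_plus]; ring.
Qed.

Lemma Cmod_Cexp a : Cmod (Cexp a) = exp (Re a).
Proof.
  unfold Cmod, Cexp; cbn [fst snd].
  replace (_ + _)%R with (Rsqr (exp (Re a)))%R.
  - apply sqrt_Rsqr; left; apply exp_pos.
  - generalize (sin2_cos2 (Im a)); unfold Rsqr; intros H.
    transitivity (exp (Re a) * exp (Re a) * (sin (Im a) * sin (Im a) + cos (Im a) * cos (Im a)))%R;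
      [rewrite H|]; ring.
Qed.

Lemma Im_le_Cmod (z : C) : (Rabs (Im z) <= Cmod z)%R.
Proof. eapply Rle_trans; [apply Rmax_r|apply Rmax_Cmod]. Qed.

Lemma Cmod_le_Re_Im (z : C) : (Cmod z <= Rabs (Re z) + Rabs (Im z))%R.
Proof.
  replace z with (RtoC (Re z) + Ci * RtoC (Im z)) at 1
    by (apply C_eq; unfold Re, Im; simpl; ring).
  eapply Rle_trans; [apply Cmod_triangle|].
  rewrite Cmod_mult, Cmod_Ci, !Cmod_R; lra.
Qed.

(** The weight kappa, later |u1^a u2^b|, may vanish; keeping it in the statement
    avoids dividing by it. *)
Lemma taylor_real (f f1 f2 : R -> R) (kappa B : R) :
  (forall s, is_derive f s (f1 s)) -> (forall s, is_derive f1 s (f2 s)) ->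
  (0 <= kappa)%R -> (forall s, 0 <= s <= 1 -> kappa * Rabs (f2 s) <= B)%R ->
  (kappa * Rabs (f 1 - f 0 - f1 0) <= B)%R.
Proof.
  intros D1 D2 Hk HB.
  assert (MV : forall g g' : R -> R, (forall s, is_derive g s (g' s)) -> forall x, (0 <= x)%R ->
    exists c, (0 <= c <= x)%R /\ (g x - g 0 = g' c * x)%R).
  { intros g g' D x Hx.
    destruct (MVT_gen g 0 x g') as [c [Hc E]].
    - intros y _; apply D.
    - intros y _. apply derivable_continuous_pt; exists (g' y); apply is_derive_Reals, D.
    - rewrite Rmin_left, Rmax_right in Hc by lra.
      exists c; split; [exact Hc|]. rewrite E; ring. }
  destruct (MV f f1 D1 1%R ltac:(lra)) as [c [Hc E]].
  destruct (MV f1 f2 D2 c ltac:(lra)) as [b [Hb E2]].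
  replace (f 1 - f 0 - f1 0)%R with (f2 b * c)%R by lra.
  rewrite Rabs_mult, (Rabs_pos_eq c) by lra.
  specialize (HB b ltac:(lra)).
  pose proof (Rabs_pos (f2 b)).
  assert (0 <= kappa * Rabs (f2 b))%R by now apply Rmult_le_pos.
  nra.
Qed.

Lemma taylor_complex (g g1 g2 : R -> C) (kappa B : R) :
  (forall s, rderive g s (g1 s)) -> (forall s, rderive g1 s (g2 s)) ->
  (0 <= kappa)%R -> (forall s, 0 <= s <= 1 -> kappa * Cmod (g2 s) <= B)%R ->
  (kappa * Cmod (g 1%R - g 0%R - g1 0%R) <= 2 * B)%R.
Proof.
  intros D1 D2 Hk HB.
  assert (HR : (kappa * Rabs (Re (g 1%R) - Re (g 0%R) - Re (g1 0%R)) <= B)%R).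
  { apply (taylor_real (fun s => Re (g s)) (fun s => Re (g1 s)) (fun s => Re (g2 s))); trivial.
    - intros s; apply D1.
    - intros s; apply D2.
    - intros s Hs. eapply Rle_trans; [|apply (HB s Hs)].
      apply Rmult_le_compat_l; [exact Hk|apply re_le_Cmod]. }
  assert (HI : (kappa * Rabs (Im (g 1%R) - Im (g 0%R) - Im (g1 0%R)) <= B)%R).
  { apply (taylor_real (fun s => Im (g s)) (fun s => Im (g1 s)) (fun s => Im (g2 s))); trivial.
    - intros s; apply D1.
    - intros s; apply D2.
    - intros s Hs. eapply Rle_trans; [|apply (HB s Hs)].
      apply Rmult_le_compat_l; [exact Hk|apply Im_le_Cmod]. }
  eapply Rle_trans; [apply Rmult_le_compat_l; [exact Hk|apply Cmod_le_Re_Im]|].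
  rewrite Rmult_plus_distr_l.
  replace (Re (g 1%R - g 0%R - g1 0%R)) with (Re (g 1%R) - Re (g 0%R) - Re (g1 0%R))%R
    by (unfold Re, Im; simpl; ring).
  replace (Im (g 1%R - g 0%R - g1 0%R)) with (Im (g 1%R) - Im (g 0%R) - Im (g1 0%R))%R
    by (unfold Re, Im; simpl; ring).
  lra.
Qed.

(** * Polynomials times Gaussians *)

Inductive coord := U1 | U2 | W1 | T1 | W2 | T2.

Lemma coord_eq_dec (x y : coord) : {x = y} + {x <> y}.
Proof. decide equality. Defined.

(** Polynomials in the variables u1, u2 and the Gaussian parameters w1, t1, w2,
    t2, kept as syntax: differentiation is then a function on expressions, the
    mixed derivatives of all orders of polynomial times Gaussian stay in one
    class, and one induction bounds them all. *)
Inductive poly_expr :=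
  | PC (c : C)
  | PV (x : coord)
  | PAdd (e f : poly_expr)
  | PMul (e f : poly_expr).

Fixpoint poly_eval (e : poly_expr) (rho : coord -> C) : C :=
  match e with
  | PC c => c
  | PV x => rho x
  | PAdd e f => poly_eval e rho + poly_eval f rho
  | PMul e f => poly_eval e rho * poly_eval f rho
  end.

Fixpoint poly_diff (x : coord) (e : poly_expr) : poly_expr :=
  match e with
  | PC _ => PC 0
  | PV y => PC (if coord_eq_dec x y then 1 else 0)
  | PAdd e f => PAdd (poly_diff x e) (poly_diff x f)
  | PMul e f => PAdd (PMul (poly_diff x e) f) (PMul e (poly_diff x f))
  end.

Definition vsum (F : coord -> C) : C := F U1 + F U2 + F W1 + F T1 + F W2 + F T2.

Lemma poly_diff_comm x y e rho :
  poly_eval (poly_diff x (poly_diff y e)) rho = poly_eval (poly_diff y (poly_diff x e)) rho.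
Proof. induction e; simpl; try rewrite IHe1, IHe2; ring. Qed.

(** The chain rule along an arbitrary curve.  It yields the derivatives in u1 and
    u2 (coordinate curves) and those in the parameters (lines in C^4). *)
Lemma poly_eval_chain (rho : R -> coord -> C) (d : coord -> C) s e :
  (forall x, rderive (fun t => rho t x) s (d x)) ->
  rderive (fun t => poly_eval e (rho t)) s (vsum (fun x => d x * poly_eval (poly_diff x e) (rho s))).
Proof.
  intros Hd; induction e as [c|y|e IHe f IHf|e IHe f IHf]; simpl.
  - eapply rderive_eq; [apply rderive_const|]. unfold vsum; ring.
  - eapply rderive_eq; [apply Hd|]. unfold vsum; destruct y; simpl; ring.
  - eapply rderive_eq; [apply rderive_plus; eassumption|]. unfold vsum; ring.
  - eapply rderive_eq; [apply rderive_mult; eassumption|]. unfold vsum; ring.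
Qed.

Definition PSub e f := PAdd e (PMul (PC (-1)) f).

Definition PSqr e := PMul e e.

Definition alpha (hbar : R) : C := RtoC (PI * hbar) * Ci.

(** The exponent alpha (w1 (u1 - t1)^2 + w2 (u2 - t2)^2).  Centred at t_j = z_j / w_j
    it is the exponent of the metamorphism kernel up to the factor that
    [calG] absorbs; in these coordinates the heat equation for each factor is visible. *)
Definition phase (hbar : R) : poly_expr :=
  PMul (PC (alpha hbar))
    (PAdd (PMul (PV W1) (PSqr (PSub (PV U1) (PV T1))))
          (PMul (PV W2) (PSqr (PSub (PV U2) (PV T2))))).

Definition gauss_val (hbar : R) (e : poly_expr) (rho : coord -> C) : C :=
  poly_eval e rho * Cexp (poly_eval (phase hbar) rho).

(** The derivative of e exp(phase) in direction x is gauss_diff x e times exp(phase). *)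
Definition gauss_diff (hbar : R) (x : coord) (e : poly_expr) : poly_expr :=
  PAdd (poly_diff x e) (PMul e (poly_diff x (phase hbar))).

Lemma gauss_val_chain hbar (rho : R -> coord -> C) (d : coord -> C) s e :
  (forall x, rderive (fun t => rho t x) s (d x)) ->
  rderive (fun t => gauss_val hbar e (rho t)) s
    (vsum (fun x => d x * gauss_val hbar (gauss_diff hbar x e) (rho s))).
Proof.
  intros Hd; unfold gauss_val.
  eapply rderive_eq.
  - apply rderive_mult; [apply poly_eval_chain; exact Hd|].
    apply rderive_Cexp, poly_eval_chain; exact Hd.
  - unfold vsum, gauss_diff; cbn [poly_eval]; ring.
Qed.

Lemma gauss_diff_comm hbar x y e rho :
  gauss_val hbar (gauss_diff hbar x (gauss_diff hbar y e)) rho = gauss_val hbar (gauss_diff hbar y (gauss_diff hbar x e)) rho.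
Proof.
  unfold gauss_val, gauss_diff; f_equal. cbn [poly_eval poly_diff].
  rewrite (poly_diff_comm x y e), (poly_diff_comm x y (phase hbar)). ring.
Qed.

(** Equality of values on all environments, since formal derivatives taken in a
    different order are different expressions. *)
Definition gauss_equiv hbar e f := forall rho, gauss_val hbar e rho = gauss_val hbar f rho.

(** Formal differentiation respects equality of values because it computes an
    actual derivative, which is unique. *)
Lemma gauss_diff_equiv hbar x e f :
  gauss_equiv hbar e f -> gauss_equiv hbar (gauss_diff hbar x e) (gauss_diff hbar x f).
Proof.
  intros E rho.
  (* gauss_diff x is the derivative along the line through rho in direction x *)
  set (d := fun y => if coord_eq_dec x y then RtoC 1 else RtoC 0).
  set (curve := fun (t : R) y => rho y + RtoC t * d y).
  assert (E0 : curve 0%R = rho).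
  { apply functional_extensionality; intros y; unfold curve; ring. }
  assert (Hd : forall y, rderive (fun t => curve t y) 0 (d y)).
  { intros y; apply rderive_affine. }
  assert (S : forall e', vsum (fun y => d y * gauss_val hbar (gauss_diff hbar y e') rho) =
                 gauss_val hbar (gauss_diff hbar x e') rho).
  { intros e'; unfold vsum, d; destruct x; simpl; ring. }
  rewrite <- (S e), <- (S f).
  generalize (gauss_val_chain hbar curve d 0 e Hd) (gauss_val_chain hbar curve d 0 f Hd).
  rewrite E0; intros He Hf.
  eapply rderive_unique; [exact He|].
  eapply rderive_ext; [|exact Hf]. intros t; symmetry; apply E.
Qed.

Fixpoint gauss_diffn hbar x n e :=
  match n with O => e | S n => gauss_diff hbar x (gauss_diffn hbar x n e) end.

Lemma gauss_diffn_equiv hbar x n e f :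
  gauss_equiv hbar e f -> gauss_equiv hbar (gauss_diffn hbar x n e) (gauss_diffn hbar x n f).
Proof. intros E; induction n; simpl; [exact E|now apply gauss_diff_equiv]. Qed.

Lemma gauss_diffn_comm hbar x y n e :
  gauss_equiv hbar (gauss_diff hbar x (gauss_diffn hbar y n e)) (gauss_diffn hbar y n (gauss_diff hbar x e)).
Proof.
  induction n as [|n IH]; simpl; intros rho; [reflexivity|].
  rewrite gauss_diff_comm. apply gauss_diff_equiv; exact IH.
Qed.

Definition gauss_mix hbar m n e := gauss_diffn hbar U1 m (gauss_diffn hbar U2 n e).

(** Parameter derivatives pass through the u-derivatives: this lets one estimate
    every seminorm of a Taylor remainder in the parameters by Taylor's formula
    for one function of one variable. *)
Lemma gauss_mix_comm hbar x m n e :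
  gauss_equiv hbar (gauss_diff hbar x (gauss_mix hbar m n e)) (gauss_mix hbar m n (gauss_diff hbar x e)).
Proof.
  intros rho; unfold gauss_mix. rewrite gauss_diffn_comm. apply gauss_diffn_equiv, gauss_diffn_comm.
Qed.

(** * Schwartz functions with all their derivatives, and tempered distributions *)

(** A smooth function given together with all its mixed derivatives.  Linear
    combinations of jets are jets termwise, so that closure of the Schwartz
    class under them needs no calculus of iterated Derive. *)
Definition jet := nat -> nat -> R -> R -> C.

Definition is_jet (P : jet) : Prop :=
  (forall m n u1 u2, rderive (fun s => P m n s u2) u1 (P (S m) n u1 u2)) /\
  (forall m n u1 u2, rderive (fun s => P m n u1 s) u2 (P m (S n) u1 u2)) /\
  (forall m n u1 u2, continuity_2d_pt (fun s t => Re (P m n s t)) u1 u2 /\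
                     continuity_2d_pt (fun s t => Im (P m n s t)) u1 u2).

Definition jet_bounded (a b m n : nat) (P : jet) (B : R) : Prop :=
  forall u1 u2, (Rabs (u1 ^ a * u2 ^ b) * Cmod (P m n u1 u2) <= B)%R.

Definition schwartz_jet (P : jet) : Prop :=
  is_jet P /\ forall a b m n, exists B, jet_bounded a b m n P B.

Lemma is_jet_cpartial P m n : is_jet P -> cpartial m n (P O O) = P m n.
Proof.
  intros [H1 [H2 _]].
  assert (D2 : forall k u1 u2,
    Derive_n (fun t => Re (P O O u1 t)) k u2 = Re (P O k u1 u2) /\
    Derive_n (fun t => Im (P O O u1 t)) k u2 = Im (P O k u1 u2)).
  { induction k as [|k IH]; intros u1 u2; simpl; [split; reflexivity|]. split.
    - rewrite (Derive_ext _ (fun t => Re (P O k u1 t))); [|intros; apply IH].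
      apply is_derive_unique; exact (proj1 (H2 O k u1 u2)).
    - rewrite (Derive_ext _ (fun t => Im (P O k u1 t))); [|intros; apply IH].
      apply is_derive_unique; exact (proj2 (H2 O k u1 u2)). }
  assert (D1 : forall j u1 u2,
    Derive_n (fun s => Re (P O n s u2)) j u1 = Re (P j n u1 u2) /\
    Derive_n (fun s => Im (P O n s u2)) j u1 = Im (P j n u1 u2)).
  { induction j as [|j IH]; intros u1 u2; simpl; [split; reflexivity|]. split.
    - rewrite (Derive_ext _ (fun t => Re (P j n t u2))); [|intros; apply IH].
      apply is_derive_unique; exact (proj1 (H1 j n u1 u2)).
    - rewrite (Derive_ext _ (fun t => Im (P j n t u2))); [|intros; apply IH].
      apply is_derive_unique; exact (proj2 (H1 j n u1 u2)). }
  apply functional_extensionality; intros u1; apply functional_extensionality; intros u2.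
  unfold cpartial, partial_derive; apply C_eq; cbn [Re Im fst snd].
  - rewrite (Derive_n_ext _ (fun s => Re (P O n s u2))); [apply D1|intros; apply D2].
  - rewrite (Derive_n_ext _ (fun s => Im (P O n s u2))); [apply D1|intros; apply D2].
Qed.

Lemma is_jet_smooth P : is_jet P -> smooth (P O O).
Proof.
  intros [H1 [H2 H3]].
  assert (K : forall N m n u1 u2, ex_diff_n (fun s t => Re (P m n s t)) N u1 u2 /\
    ex_diff_n (fun s t => Im (P m n s t)) N u1 u2).
  { induction N as [|N IH]; intros m n u1 u2; simpl.
    - split; (split; [apply H3|exact I]).
    - split; (split; [apply H3|]).
      + split; [exists (Re (P (S m) n u1 u2)); exact (proj1 (H1 m n u1 u2))|].
        split; [exists (Re (P m (S n) u1 u2)); exact (proj1 (H2 m n u1 u2))|]. split.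
        * replace (fun u v => Derive (fun z => Re (P m n z v)) u)
            with (fun s t => Re (P (S m) n s t)); [apply IH|].
          apply functional_extensionality; intros s; apply functional_extensionality; intros t.
          symmetry; apply is_derive_unique; exact (proj1 (H1 m n s t)).
        * replace (fun u v => Derive (fun z => Re (P m n u z)) v)
            with (fun s t => Re (P m (S n) s t)); [apply IH|].
          apply functional_extensionality; intros s; apply functional_extensionality; intros t.
          symmetry; apply is_derive_unique; exact (proj1 (H2 m n s t)).
      + split; [exists (Im (P (S m) n u1 u2)); exact (proj2 (H1 m n u1 u2))|].
        split; [exists (Im (P m (S n) u1 u2)); exact (proj2 (H2 m n u1 u2))|]. split.
        * replace (fun u v => Derive (fun z => Im (P m n z v)) u)
            with (fun s t => Im (P (S m) n s t)); [apply IH|].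
          apply functional_extensionality; intros s; apply functional_extensionality; intros t.
          symmetry; apply is_derive_unique; exact (proj2 (H1 m n s t)).
        * replace (fun u v => Derive (fun z => Im (P m n u z)) v)
            with (fun s t => Im (P m (S n) s t)); [apply IH|].
          apply functional_extensionality; intros s; apply functional_extensionality; intros t.
          symmetry; apply is_derive_unique; exact (proj2 (H2 m n s t)). }
  intros N u1 u2; apply K.
Qed.

Lemma schwartz_jet_schwartz P : schwartz_jet P -> schwartz (P O O).
Proof.
  intros [HP HB]; split; [now apply is_jet_smooth|].
  intros a b m n; destruct (HB a b m n) as [B H]; exists B.
  intros u1 u2; rewrite (is_jet_cpartial P m n HP); apply H.
Qed.

Definition jet_plus (P Q : jet) : jet := fun m n u1 u2 => P m n u1 u2 + Q m n u1 u2.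

Definition jet_scal (c : C) (P : jet) : jet := fun m n u1 u2 => c * P m n u1 u2.

Lemma schwartz_jet_plus P Q : schwartz_jet P -> schwartz_jet Q -> schwartz_jet (jet_plus P Q).
Proof.
  intros [[P1 [P2 P3]] PB] [[Q1 [Q2 Q3]] QB]; split; [split; [|split]|].
  - intros; apply rderive_plus; [apply P1|apply Q1].
  - intros; apply rderive_plus; [apply P2|apply Q2].
  - intros; split; simpl; apply continuity_2d_pt_plus; try apply P3; apply Q3.
  - intros a b m n; destruct (PB a b m n) as [B HB], (QB a b m n) as [D HD].
    exists (B + D)%R; intros u1 u2; unfold jet_plus.
    eapply Rle_trans; [apply Rmult_le_compat_l; [apply Rabs_pos|apply Cmod_triangle]|].
    rewrite Rmult_plus_distr_l; apply Rplus_le_compat; [apply HB|apply HD].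
Qed.

Lemma jet_bounded_scal a b m n c P B :
  jet_bounded a b m n P B -> jet_bounded a b m n (jet_scal c P) (Cmod c * B).
Proof.
  intros H u1 u2; unfold jet_scal; rewrite Cmod_mult.
  replace (_ * _)%R with (Cmod c * (Rabs (u1 ^ a * u2 ^ b) * Cmod (P m n u1 u2)))%R by ring.
  apply Rmult_le_compat_l; [apply Cmod_ge_0|apply H].
Qed.

Lemma schwartz_jet_scal c P : schwartz_jet P -> schwartz_jet (jet_scal c P).
Proof.
  intros [[P1 [P2 P3]] PB]; split; [split; [|split]|].
  - intros; eapply rderive_eq; [apply rderive_mult; [apply rderive_const|apply P1]|].
    unfold jet_scal; ring.
  - intros; eapply rderive_eq; [apply rderive_mult; [apply rderive_const|apply P2]|].
    unfold jet_scal; ring.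
  - intros; split; simpl.
    + apply continuity_2d_pt_minus; apply continuity_2d_pt_mult;
        try apply continuity_2d_pt_const; apply P3.
    + apply continuity_2d_pt_plus; apply continuity_2d_pt_mult;
        try apply continuity_2d_pt_const; apply P3.
  - intros a b m n; destruct (PB a b m n) as [B HB].
    exists (Cmod c * B)%R; now apply jet_bounded_scal.
Qed.

Lemma schwartz_jet_zero : schwartz_jet (fun _ _ _ _ => RtoC 0).
Proof.
  split; [split; [|split]|].
  - intros; apply rderive_const.
  - intros; apply rderive_const.
  - intros; split; apply continuity_2d_pt_const.
  - intros a b m n; exists 0%R; intros u1 u2; rewrite Cmod_0; lra.
Qed.

Lemma tempered_plus T P Q : tempered T -> schwartz_jet P -> schwartz_jet Q ->
  T (jet_plus P Q O O) = T (P O O) + T (Q O O).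
Proof. intros [H _] HP HQ; apply H; now apply schwartz_jet_schwartz. Qed.

Lemma tempered_scal T c P : tempered T -> schwartz_jet P ->
  T (jet_scal c P O O) = c * T (P O O).
Proof. intros [_ [H _]] HP; apply H; now apply schwartz_jet_schwartz. Qed.

(** Continuity at 0 alone gives, by homogeneity, a bound of T by finitely many
    seminorms; this is the only form in which continuity is used below. *)
Lemma tempered_bound T : tempered T -> exists (N : nat) (K : R), (0 < K)%R /\
  forall (P : jet) (B : R), schwartz_jet P -> (0 < B)%R ->
    (forall a b m n, (a <= N)%nat -> (b <= N)%nat -> (m <= N)%nat -> (n <= N)%nat ->
       jet_bounded a b m n P B) ->
    (Cmod (T (P O O)) <= K * B)%R.
Proof.
  intros HT; pose proof HT as [_ [Hs Hc]].
  pose proof (schwartz_jet_schwartz _ schwartz_jet_zero) as S0; cbv beta in S0.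
  assert (T0 : T (fun _ _ => RtoC 0) = 0).
  { pose proof (Hs 0 _ S0) as H. rewrite Cmult_0_l in H.
    replace (fun _ _ : R => 0 * 0) with (fun _ _ : R => RtoC 0) in H; [exact H|].
    apply functional_extensionality; intros; apply functional_extensionality; intros; ring. }
  destruct (Hc _ S0 (mkposreal 1 Rlt_0_1)) as [N [delta HN]].
  exists N, (/ delta)%R. split; [apply Rinv_0_lt_compat, cond_pos|].
  intros P B HP HB HPB.
  assert (Hd : (0 < delta / B)%R) by (apply Rdiv_lt_0_compat; [apply cond_pos|exact HB]).
  (* P rescaled so that the relevant seminorms are at most delta *)
  set (Q := jet_scal (RtoC (delta / B)) P).
  assert (HQ : schwartz_jet Q) by now apply schwartz_jet_scal.
  specialize (HN (Q O O) (schwartz_jet_schwartz _ HQ)).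
  rewrite T0 in HN.
  replace (fun u1 u2 => Q O O u1 u2 - 0) with (Q O O) in HN.
  2: { apply functional_extensionality; intros; apply functional_extensionality; intros; ring. }
  replace (T (Q O O) - 0) with (RtoC (delta / B) * T (P O O)) in HN.
  2: { unfold Q; rewrite tempered_scal by assumption; ring. }
  assert (H1 : (Cmod (RtoC (delta / B) * T (P O O)) < 1)%R).
  { apply HN. intros a b m n Ha Hb Hm Hn u1 u2.
    rewrite (is_jet_cpartial Q m n (proj1 HQ)).
    generalize (jet_bounded_scal a b m n (RtoC (delta / B)) P B (HPB a b m n Ha Hb Hm Hn) u1 u2).
    rewrite Cmod_R, (Rabs_pos_eq (delta / B)) by lra.
    replace (delta / B * B)%R with (pos delta); [exact (fun H => H)|]. field; lra. }
  rewrite Cmod_mult, Cmod_R, Rabs_pos_eq in H1 by lra.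
  apply (Rmult_le_reg_l (delta / B)); [exact Hd|].
  replace (delta / B * (/ delta * B))%R with 1%R; [lra|].
  pose proof (cond_pos delta); field; lra.
Qed.

(** * Uniform Schwartz estimates for Gaussians *)

(** Parameters are ordered (t1, w1, t2, w2), to match the order (z1, w1, z2, w2)
    on the domain of f4. *)
Definition env (u1 u2 : R) (p : C4) (x : coord) : C :=
  let '(t1, w1, t2, w2) := p in
  match x with
  | U1 => RtoC u1 | U2 => RtoC u2
  | W1 => w1 | T1 => t1 | W2 => w2 | T2 => t2
  end.

(** Sets of parameters over which all Gaussian estimates are uniform. *)
Definition region (c M : R) (p : C4) : Prop :=
  let '(t1, w1, t2, w2) := p in
  (c <= Im w1 /\ c <= Im w2 /\ Cmod w1 <= M /\ Cmod t1 <= M /\ Cmod w2 <= M /\ Cmod t2 <= M)%R.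

(** From x^n / n! <= exp x. *)
Lemma pow_mul_exp_bounded (n : nat) :
  exists K, (0 <= K)%R /\ forall x, (0 <= x)%R -> (x ^ n * exp (- x) <= K)%R.
Proof.
  exists (INR (Factorial.fact n)); split; [apply pos_INR|].
  intros x Hx.
  assert (H : (x ^ n / INR (Factorial.fact n) <= exp x)%R).
  { eapply Rle_trans; [|apply (exp_ge_taylor x n Hx)].
    destruct n as [|n]; [simpl; lra|].
    rewrite tech5.
    assert (0 <= sum_f_R0 (fun k => x ^ k / INR (Factorial.fact k)) n)%R; [|lra].
    apply cond_pos_sum; intros k; apply Rdiv_le_0_compat; [now apply pow_le|apply INR_fact_lt_0]. }
  pose proof (INR_fact_lt_0 n) as Hn.
  rewrite exp_Ropp.
  apply (Rmult_le_reg_r (exp x)); [apply exp_pos|].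
  rewrite Rmult_assoc, Rinv_l, Rmult_1_r by (apply Rgt_not_eq, exp_pos).
  apply (Rmult_le_compat_l (INR (Factorial.fact n))) in H; [|lra].
  replace (INR (Factorial.fact n) * (x ^ n / INR (Factorial.fact n)))%R with (x ^ n)%R in H by (field; lra).
  exact H.
Qed.

Lemma poly_eval_bound e : exists (K : R) (n : nat), (0 <= K)%R /\
  forall rho X, (1 <= X)%R -> (forall x, (Cmod (rho x) <= X)%R) ->
    (Cmod (poly_eval e rho) <= K * X ^ n)%R.
Proof.
  induction e as [c|y|e [K [n [HK IHe]]] f [L [m [HL IHf]]]|e [K [n [HK IHe]]] f [L [m [HL IHf]]]].
  - exists (Cmod c), O; split; [apply Cmod_ge_0|]; intros; simpl; lra.
  - exists 1%R, 1%nat; split; [lra|]; intros rho X H1 H; simpl. specialize (H y); lra.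
  - exists (K + L)%R, (n + m)%nat; split; [lra|]; intros rho X H1 H; simpl.
    eapply Rle_trans; [apply Cmod_triangle|].
    specialize (IHe rho X H1 H); specialize (IHf rho X H1 H).
    assert (X ^ n <= X ^ (n + m))%R by (apply Rle_pow; [lra|lia]).
    assert (X ^ m <= X ^ (n + m))%R by (apply Rle_pow; [lra|lia]).
    nra.
  - exists (K * L)%R, (n + m)%nat; split; [nra|]; intros rho X H1 H; simpl.
    rewrite Cmod_mult, pow_add.
    replace (K * L * (X ^ n * X ^ m))%R with ((K * X ^ n) * (L * X ^ m))%R by ring.
    apply Rmult_le_compat; try apply Cmod_ge_0; [now apply IHe|now apply IHf].
Qed.

(** The left side is the real part of pi i hbar w (u - t)^2 with h = pi hbar,
    t = a + i b, w = p + i q.  A negative quadratic dominates any linear term, so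
    decay like exp(-|u|) is available, uniformly in the parameters. *)
Lemma quadratic_decay (h c M u a b p q : R) :
  (0 < h -> 0 < c -> c <= q -> q <= M -> Rabs p <= M -> Rabs a <= M -> Rabs b <= M ->
   - (h * (q * ((u - a) * (u - a) - b * b) - 2 * p * (u - a) * b))
     <= (2 * h * M * M + 1) ^ 2 / (4 * h * c) + h * M ^ 3 + M - Rabs u)%R.
Proof.
  intros Hh Hc Hq HqM Hp Ha Hb.
  set (x := (u - a)%R).
  assert (Hu : (Rabs u <= Rabs x + M)%R).
  { replace u with (x + a)%R by (unfold x; ring).
    eapply Rle_trans; [apply Rabs_triang|lra]. }
  assert (H1 : (q * (b * b) <= M ^ 3)%R).
  { assert (b * b <= M * M)%R.
    { replace (b * b)%R with (Rabs b * Rabs b)%R by (rewrite <- Rabs_mult; apply Rabs_pos_eq; nra).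
      pose proof (Rabs_pos b); nra. }
    simpl; nra. }
  assert (H2 : (p * x * b <= M * M * Rabs x)%R).
  { eapply Rle_trans; [apply RRle_abs|]. rewrite !Rabs_mult.
    pose proof (Rabs_pos b); pose proof (Rabs_pos p); pose proof (Rabs_pos x).
    assert (Rabs p * Rabs b <= M * M)%R by nra. nra. }
  assert (H3 : (c * (Rabs x * Rabs x) <= q * (x * x))%R).
  { replace (Rabs x * Rabs x)%R with (x * x)%R by (rewrite <- Rabs_mult; symmetry; apply Rabs_pos_eq; nra).
    nra. }
  set (y := Rabs x) in *.
  (* completing the square: h c y^2 - (2hM^2+1) y is at least -(2hM^2+1)^2/(4hc) *)
  assert (H4 : (0 <= (2 * h * M * M + 1) ^ 2 / (4 * h * c) + h * c * (y * y) - (2 * h * M * M + 1) * y)%R).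
  { replace (_ - _)%R with ((2 * h * c * y - (2 * h * M * M + 1)) ^ 2 / (4 * h * c))%R.
    - apply Rdiv_le_0_compat; [apply pow2_ge_0|nra].
    - field; lra. }
  nra.
Qed.

Lemma Re_phase_bound hbar c M : (0 < hbar -> 0 < c ->
  exists K, forall u1 u2 p, region c M p ->
    Re (poly_eval (phase hbar) (env u1 u2 p)) <= K - (M + Rabs u1 + Rabs u2))%R.
Proof.
  intros Hh Hc.
  assert (Hph : (0 < PI * hbar)%R) by (apply Rmult_lt_0_compat; [apply PI_RGT_0|exact Hh]).
  set (K := ((2 * (PI * hbar) * M * M + 1) ^ 2 / (4 * (PI * hbar) * c) + PI * hbar * M ^ 3 + M)%R).
  exists (2 * K + M)%R.
  intros u1 u2 [[[t1 w1] t2] w2] (H1 & H2 & H3 & H4 & H5 & H6).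
  pose proof (quadratic_decay (PI * hbar) c M u1 (Re t1) (Im t1) (Re w1) (Im w1) Hph Hc) as Q1.
  pose proof (quadratic_decay (PI * hbar) c M u2 (Re t2) (Im t2) (Re w2) (Im w2) Hph Hc) as Q2.
  fold K in Q1, Q2.
  pose proof (Im_le_Cmod w1); pose proof (Im_le_Cmod w2).
  pose proof (Im_le_Cmod t1); pose proof (Im_le_Cmod t2).
  pose proof (re_le_Cmod w1); pose proof (re_le_Cmod w2).
  pose proof (re_le_Cmod t1); pose proof (re_le_Cmod t2).
  pose proof (RRle_abs (Im w1)); pose proof (RRle_abs (Im w2)).
  specialize (Q1 ltac:(lra) ltac:(lra) ltac:(lra) ltac:(lra) ltac:(lra)).
  specialize (Q2 ltac:(lra) ltac:(lra) ltac:(lra) ltac:(lra) ltac:(lra)).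
  match goal with |- (?l <= _)%R => replace l with
    (- (PI * hbar *
       (Im w1 * ((u1 - Re t1) * (u1 - Re t1) - Im t1 * Im t1) - 2 * Re w1 * (u1 - Re t1) * Im t1))
     + - (PI * hbar *
       (Im w2 * ((u2 - Re t2) * (u2 - Re t2) - Im t2 * Im t2) - 2 * Re w2 * (u2 - Re t2) * Im t2)))%R end.
  - lra.
  - simpl; unfold Re, Im; ring.
Qed.

(** Polynomial growth against exponential decay: every Schwartz seminorm of
    polynomial times Gaussian is bounded uniformly over a region. *)
Lemma gauss_val_bound hbar c M e a b : (0 < hbar)%R -> (0 < c)%R -> (1 <= M)%R ->
  exists B, (0 <= B)%R /\ forall u1 u2 p, region c M p ->
    (Rabs (u1 ^ a * u2 ^ b) * Cmod (gauss_val hbar e (env u1 u2 p)) <= B)%R.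
Proof.
  intros Hh Hc HM.
  destruct (Re_phase_bound hbar c M Hh Hc) as [K HK].
  destruct (poly_eval_bound e) as [L [n [HL He]]].
  destruct (pow_mul_exp_bounded (a + b + n)) as [D [HD HDx]].
  exists (L * exp K * D)%R; split.
  { apply Rmult_le_pos; [apply Rmult_le_pos; [exact HL|left; apply exp_pos]|exact HD]. }
  intros u1 u2 p Hp.
  (* everything is compared with v^N exp(-v) *)
  set (v := (M + Rabs u1 + Rabs u2)%R).
  pose proof (Rabs_pos u1) as A1; pose proof (Rabs_pos u2) as A2.
  assert (Hv : (1 <= v)%R) by (unfold v; lra).
  unfold gauss_val; rewrite Cmod_mult, Cmod_Cexp.
  assert (B1 : (Rabs (u1 ^ a * u2 ^ b) <= v ^ a * v ^ b)%R).
  { rewrite Rabs_mult, <- !RPow_abs.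
    apply Rmult_le_compat; try (apply pow_le; assumption);
      apply pow_incr; unfold v; lra. }
  assert (B2 : (Cmod (poly_eval e (env u1 u2 p)) <= L * v ^ n)%R).
  { apply He; [exact Hv|]. destruct p as [[[t1 w1] t2] w2]; destruct Hp as (H1 & H2 & H3 & H4 & H5 & H6).
    intros []; simpl; rewrite ?Cmod_R; unfold v; lra. }
  assert (B3 : (exp (Re (poly_eval (phase hbar) (env u1 u2 p))) <= exp K * exp (- v))%R).
  { rewrite <- exp_plus. specialize (HK u1 u2 p Hp). fold v in HK.
    destruct HK as [HK|HK]; [left; apply exp_increasing; lra|right; f_equal; lra]. }
  eapply Rle_trans.
  { apply Rmult_le_compat; [apply Rabs_pos| |exact B1|].
    - apply Rmult_le_pos; [apply Cmod_ge_0|left; apply exp_pos].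
    - apply Rmult_le_compat; [apply Cmod_ge_0|left; apply exp_pos|exact B2|exact B3]. }
  specialize (HDx v ltac:(lra)). rewrite !pow_add in HDx.
  replace (v ^ a * v ^ b * (L * v ^ n * (exp K * exp (- v))))%R
    with (L * exp K * (v ^ a * v ^ b * v ^ n * exp (- v)))%R by ring.
  apply Rmult_le_compat_l; [|exact HDx].
  apply Rmult_le_pos; [exact HL|left; apply exp_pos].
Qed.

Lemma gauss_val_continuous hbar e p u1 u2 :
  continuity_2d_pt (fun s t => Re (gauss_val hbar e (env s t p))) u1 u2 /\
  continuity_2d_pt (fun s t => Im (gauss_val hbar e (env s t p))) u1 u2.
Proof.
  assert (M : forall f g : R -> R -> C,
    (continuity_2d_pt (fun s t => Re (f s t)) u1 u2 /\ continuity_2d_pt (fun s t => Im (f s t)) u1 u2) ->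
    (continuity_2d_pt (fun s t => Re (g s t)) u1 u2 /\ continuity_2d_pt (fun s t => Im (g s t)) u1 u2) ->
    (continuity_2d_pt (fun s t => Re (f s t * g s t)) u1 u2 /\
     continuity_2d_pt (fun s t => Im (f s t * g s t)) u1 u2)).
  { intros f g [F1 F2] [G1 G2]; split; simpl.
    - apply continuity_2d_pt_minus; apply continuity_2d_pt_mult; assumption.
    - apply continuity_2d_pt_plus; apply continuity_2d_pt_mult; assumption. }
  assert (E : forall e,
    continuity_2d_pt (fun s t => Re (poly_eval e (env s t p))) u1 u2 /\
    continuity_2d_pt (fun s t => Im (poly_eval e (env s t p))) u1 u2).
  { clear e; induction e as [c|y|e [IH1 IH2] f [IH3 IH4]|e IHe f IHf].
    - split; simpl; apply continuity_2d_pt_const.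
    - destruct p as [[[t1 w1] t2] w2]; destruct y; simpl; split;
        first [apply continuity_2d_pt_const|apply continuity_2d_pt_id1|apply continuity_2d_pt_id2].
    - split; simpl; apply continuity_2d_pt_plus; assumption.
    - apply (M (fun s t => poly_eval e (env s t p)) (fun s t => poly_eval f (env s t p))); assumption. }
  apply (M (fun s t => poly_eval e (env s t p)) (fun s t => Cexp (poly_eval (phase hbar) (env s t p))));
    [apply E|].
  destruct (E (phase hbar)) as [E1 E2].
  split; simpl; apply continuity_2d_pt_mult.
  - apply (continuity_1d_2d_pt_comp exp); [|exact E1].
    apply derivable_continuous_pt, derivable_pt_exp.
  - apply (continuity_1d_2d_pt_comp cos); [|exact E2]. apply continuity_cos.
  - apply (continuity_1d_2d_pt_comp exp); [|exact E1].
    apply derivable_continuous_pt, derivable_pt_exp.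
  - apply (continuity_1d_2d_pt_comp sin); [|exact E2]. apply continuity_sin.
Qed.

Definition gauss_jet hbar e (p : C4) : jet := fun m n u1 u2 => gauss_val hbar (gauss_mix hbar m n e) (env u1 u2 p).

Lemma gauss_jet_is_jet hbar e p : is_jet (gauss_jet hbar e p).
Proof.
  split; [|split].
  - intros m n u1 u2.
    eapply rderive_eq.
    + apply (gauss_val_chain hbar (fun s => env s u2 p) (fun x => if coord_eq_dec x U1 then 1 else 0)).
      destruct p as [[[t1 w1] t2] w2]; intros []; simpl; try apply rderive_const.
      split; simpl; [apply (is_derive_id (K := R_AbsRing))|apply (is_derive_const (V := R_NormedModule))].
    + unfold vsum; simpl; unfold gauss_jet, gauss_mix; simpl; ring.
  - intros m n u1 u2.
    eapply rderive_eq.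
    + apply (gauss_val_chain hbar (fun s => env u1 s p) (fun x => if coord_eq_dec x U2 then 1 else 0)).
      destruct p as [[[t1 w1] t2] w2]; intros []; simpl; try apply rderive_const.
      split; simpl; [apply (is_derive_id (K := R_AbsRing))|apply (is_derive_const (V := R_NormedModule))].
    + unfold vsum; simpl. unfold gauss_jet, gauss_mix.
      rewrite (gauss_diffn_comm hbar U2 U1 m). simpl. ring.
  - intros; apply gauss_val_continuous.
Qed.

Lemma upper4_region p : upper4 p -> exists c M, (0 < c)%R /\ (1 <= M)%R /\ region c M p.
Proof.
  destruct p as [[[t1 w1] t2] w2]; intros [H1 H2].
  exists (Rmin (Im w1) (Im w2)), (1 + Cmod w1 + Cmod t1 + Cmod w2 + Cmod t2)%R.
  pose proof (Cmod_ge_0 w1); pose proof (Cmod_ge_0 w2); pose proof (Cmod_ge_0 t1); pose proof (Cmod_ge_0 t2).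
  split; [now apply Rmin_glb_lt|split; [lra|]].
  pose proof (Rmin_l (Im w1) (Im w2)); pose proof (Rmin_r (Im w1) (Im w2)).
  simpl; repeat split; lra.
Qed.

Lemma gauss_jet_schwartz hbar e p : (0 < hbar)%R -> upper4 p -> schwartz_jet (gauss_jet hbar e p).
Proof.
  intros Hh Hp; split; [apply gauss_jet_is_jet|].
  destruct (upper4_region p Hp) as [c [M [Hc [HM Hr]]]].
  intros a b m n.
  destruct (gauss_val_bound hbar c M (gauss_mix hbar m n e) a b Hh Hc HM) as [B [_ HB]].
  exists B; intros u1 u2; now apply HB.
Qed.

(** * Taylor expansion in the parameters *)

(** The value on d of the complex-linear form whose coefficients are the four
    parameter partials F. *)
Definition paramsum (d : C4) (F : coord -> C) : C :=
  let '(t1, w1, t2, w2) := d in t1 * F T1 + w1 * F W1 + t2 * F T2 + w2 * F W2.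

Lemma paramsum_bound d F r B :
  (forall x, Cmod (env 0 0 d x) <= r)%R -> (forall x, Cmod (F x) <= B)%R ->
  (Cmod (paramsum d F) <= 4 * (r * B))%R.
Proof.
  destruct d as [[[t1 w1] t2] w2]; intros Hd HF.
  assert (K : forall (z : C) x, (Cmod z <= r)%R -> (Cmod (z * F x) <= r * B)%R).
  { intros z x Hz; rewrite Cmod_mult; apply Rmult_le_compat; try apply Cmod_ge_0; auto. }
  pose proof (K t1 T1 (Hd T1)); pose proof (K w1 W1 (Hd W1)).
  pose proof (K t2 T2 (Hd T2)); pose proof (K w2 W2 (Hd W2)).
  unfold paramsum.
  eapply Rle_trans; [apply Cmod_triangle|].
  eapply Rle_trans; [apply Rplus_le_compat_r; apply Cmod_triangle|].
  eapply Rle_trans; [apply Rplus_le_compat_r; apply Rplus_le_compat_r; apply Cmod_triangle|].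
  lra.
Qed.

Lemma paramsum_rderive d (F : R -> coord -> C) (F' : coord -> C) s :
  (forall x, rderive (fun t => F t x) s (F' x)) ->
  rderive (fun t => paramsum d (F t)) s (paramsum d F').
Proof.
  destruct d as [[[t1 w1] t2] w2]; intros H; simpl.
  assert (K : forall c x, rderive (fun t => c * F t x) s (c * F' x)).
  { intros c x; eapply rderive_eq; [apply rderive_mult; [apply rderive_const|apply H]|]. cbv beta; ring. }
  apply rderive_plus; [apply rderive_plus; [apply rderive_plus|]|]; apply K.
Qed.

Definition pline (p d : C4) (s : R) : C4 := plus p (scal (RtoC s) d).

Lemma gauss_val_pline hbar e p d u1 u2 s :
  rderive (fun t => gauss_val hbar e (env u1 u2 (pline p d t))) s
    (paramsum d (fun x => gauss_val hbar (gauss_diff hbar x e) (env u1 u2 (pline p d s)))).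
Proof.
  eapply rderive_eq.
  - apply (gauss_val_chain hbar (fun t => env u1 u2 (pline p d t)) (env 0 0 d)).
    destruct p as [[[t1 w1] t2] w2], d as [[[dt1 dw1] dt2] dw2]. intros [].
    + exact (rderive_const (RtoC u1) s).
    + exact (rderive_const (RtoC u2) s).
    + exact (rderive_affine w1 dw1 s).
    + exact (rderive_affine t1 dt1 s).
    + exact (rderive_affine w2 dw2 s).
    + exact (rderive_affine t2 dt2 s).
  - destruct d as [[[dt1 dw1] dt2] dw2]. unfold vsum; simpl. ring.
Qed.

(** The first-order Taylor remainder in the parameters ([remainder_eq]), written as
    a combination of Gaussian jets so that it is visibly a Schwartz jet. *)
Definition remainder hbar e (p d : C4) : jet :=
  let J x := gauss_jet hbar (gauss_diff hbar x e) p in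
  let '(t1, w1, t2, w2) := d in
  jet_plus (gauss_jet hbar e (plus p d))
    (jet_scal (-1) (jet_plus (gauss_jet hbar e p)
      (jet_plus (jet_plus (jet_plus (jet_scal t1 (J T1)) (jet_scal w1 (J W1)))
         (jet_scal t2 (J T2))) (jet_scal w2 (J W2))))).

Lemma remainder_eq hbar e p d m n u1 u2 :
  remainder hbar e p d m n u1 u2 =
  gauss_jet hbar e (plus p d) m n u1 u2 - gauss_jet hbar e p m n u1 u2
  - paramsum d (fun x => gauss_jet hbar (gauss_diff hbar x e) p m n u1 u2).
Proof.
  destruct d as [[[t1 w1] t2] w2]; unfold remainder, jet_plus, jet_scal, paramsum; ring.
Qed.

Lemma pline_0 p d : pline p d 0 = p.
Proof.
  exact (eq_trans (f_equal (plus p) (scal_zero_l (K := C_AbsRing) (V := C4) d)) (plus_zero_r p)).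
Qed.

Lemma pline_1 p d : pline p d 1 = plus p d.
Proof.
  unfold pline. f_equal. apply (scal_one (K := C_AbsRing) (V := C4)).
Qed.

(** Taylor along the segment from p to p + d: the second derivative has 16 terms,
    each quadratic in d. *)
Lemma remainder_bound hbar e p d m n u1 u2 kappa B r :
  (0 <= kappa)%R -> (forall x, Cmod (env 0 0 d x) <= r)%R ->
  (forall s x y, 0 <= s <= 1 ->
     kappa * Cmod (gauss_val hbar (gauss_diff hbar x (gauss_diff hbar y (gauss_mix hbar m n e)))
              (env u1 u2 (pline p d s))) <= B)%R ->
  (kappa * Cmod (remainder hbar e p d m n u1 u2) <= 32 * B * r ^ 2)%R.
Proof.
  intros Hk Hd HB.
  set (e' := gauss_mix hbar m n e).
  set (E := fun s => env u1 u2 (pline p d s)).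
  assert (H : (kappa * Cmod (gauss_val hbar e' (E 1%R) - gauss_val hbar e' (E 0%R)
     - paramsum d (fun y => gauss_val hbar (gauss_diff hbar y e') (E 0%R))) <= 2 * (16 * B * r ^ 2))%R).
  { apply (taylor_complex (fun s => gauss_val hbar e' (E s))
      (fun s => paramsum d (fun y => gauss_val hbar (gauss_diff hbar y e') (E s)))
      (fun s => paramsum d (fun y => paramsum d (fun x => gauss_val hbar (gauss_diff hbar x (gauss_diff hbar y e')) (E s))))).
    - intros s; apply gauss_val_pline.
    - intros s; apply (paramsum_rderive d (fun s y => gauss_val hbar (gauss_diff hbar y e') (E s))).
      intros y; apply gauss_val_pline.
    - exact Hk.
    - intros s Hs.
      replace (kappa * Cmod (paramsum d (fun y => paramsum d (fun x => gauss_val hbar (gauss_diff hbar x (gauss_diff hbar y e')) (E s)))))%R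
        with (Cmod (paramsum d (fun y => paramsum d (fun x => RtoC kappa * gauss_val hbar (gauss_diff hbar x (gauss_diff hbar y e')) (E s))))).
      + replace (16 * B * r ^ 2)%R with (4 * (r * (4 * (r * B))))%R by ring.
        apply paramsum_bound; [exact Hd|]; intros y.
        apply paramsum_bound; [exact Hd|]; intros x.
        rewrite Cmod_mult, Cmod_R, Rabs_pos_eq by exact Hk. now apply HB.
      + match goal with |- _ = (_ * Cmod ?z)%R => transitivity (Cmod (RtoC kappa * z)) end.
        2: now rewrite Cmod_mult, Cmod_R, Rabs_pos_eq by exact Hk.
        f_equal.
        destruct d as [[[dt1 dw1] dt2] dw2]; simpl; ring. }
  replace (32 * B * r ^ 2)%R with (2 * (16 * B * r ^ 2))%R by ring.
  eapply Rle_trans; [|exact H]. apply Req_le. f_equal. f_equal.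
  rewrite remainder_eq. unfold gauss_jet, E. rewrite pline_0, pline_1. f_equal. f_equal.
  apply functional_extensionality; intros x. symmetry; apply gauss_mix_comm.
Qed.

Lemma coord_uniform (P : coord -> R -> Prop) :
  (forall x B B', (B <= B')%R -> P x B -> P x B') ->
  (forall x, exists B, P x B) -> exists B, forall x, P x B.
Proof.
  intros Hm H.
  destruct (H U1) as [B1 H1], (H U2) as [B2 H2], (H W1) as [B3 H3], (H T1) as [B4 H4],
    (H W2) as [B5 H5], (H T2) as [B6 H6].
  pose proof (Rabs_pos B1); pose proof (Rabs_pos B2); pose proof (Rabs_pos B3).
  pose proof (Rabs_pos B4); pose proof (Rabs_pos B5); pose proof (Rabs_pos B6).
  pose proof (RRle_abs B1); pose proof (RRle_abs B2); pose proof (RRle_abs B3).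
  pose proof (RRle_abs B4); pose proof (RRle_abs B5); pose proof (RRle_abs B6).
  exists (Rabs B1 + Rabs B2 + Rabs B3 + Rabs B4 + Rabs B5 + Rabs B6)%R.
  intros []; (eapply Hm; [|eassumption]; lra).
Qed.

Lemma nat_uniform (P : nat -> R -> Prop) (N : nat) :
  (forall n B B', (B <= B')%R -> P n B -> P n B') ->
  (forall n, exists B, P n B) -> exists B, forall n, (n <= N)%nat -> P n B.
Proof.
  intros Hm H; induction N as [|N [B IH]].
  - destruct (H O) as [B HB]; exists B; intros n Hn; now replace n with O by lia.
  - destruct (H (S N)) as [D HD]; exists (Rmax B D); intros n Hn.
    destruct (Nat.eq_dec n (S N)) as [->|Hne].
    + eapply Hm; [apply Rmax_r|exact HD].
    + eapply Hm; [apply Rmax_l|apply IH; lia].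
Qed.

Lemma gauss_val_uniform_bound hbar c M e N : (0 < hbar)%R -> (0 < c)%R -> (1 <= M)%R ->
  exists B, forall a, (a <= N)%nat -> forall b, (b <= N)%nat ->
    forall m, (m <= N)%nat -> forall n, (n <= N)%nat -> forall x y u1 u2 p, region c M p ->
      (Rabs (u1 ^ a * u2 ^ b) *
        Cmod (gauss_val hbar (gauss_diff hbar x (gauss_diff hbar y (gauss_mix hbar m n e))) (env u1 u2 p)) <= B)%R.
Proof.
  intros Hh Hc HM.
  apply nat_uniform; [intros; eapply Rle_trans; eauto|intros a].
  apply nat_uniform; [intros; eapply Rle_trans; eauto|intros b].
  apply nat_uniform; [intros; eapply Rle_trans; eauto|intros m].
  apply nat_uniform; [intros; eapply Rle_trans; eauto|intros n].
  apply coord_uniform; [intros; eapply Rle_trans; eauto|intros x].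
  apply coord_uniform; [intros; eapply Rle_trans; eauto|intros y].
  destruct (gauss_val_bound hbar c M (gauss_diff hbar x (gauss_diff hbar y (gauss_mix hbar m n e))) a b Hh Hc HM) as [B [_ HB]].
  exists B; exact HB.
Qed.

Lemma region_pline c M p d r s :
  region c M p -> (0 <= s <= 1)%R -> (r <= 1)%R -> (r <= c / 2)%R ->
  (forall x, Cmod (env 0 0 d x) <= r)%R -> region (c / 2) (M + 1) (pline p d s).
Proof.
  destruct p as [[[t1 w1] t2] w2], d as [[[dt1 dw1] dt2] dw2].
  intros (H1 & H2 & H3 & H4 & H5 & H6) Hs Hr1 Hr2 Hd.
  pose proof (Hd T1) as D1; pose proof (Hd W1) as D2; pose proof (Hd T2) as D3; pose proof (Hd W2) as D4.
  simpl in D1, D2, D3, D4.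
  assert (A : forall z dz : C, (Cmod z <= M)%R -> (Cmod dz <= r)%R -> (Cmod (z + RtoC s * dz) <= M + 1)%R).
  { intros z dz Hz Hdz. eapply Rle_trans; [apply Cmod_triangle|].
    rewrite Cmod_mult, Cmod_R, Rabs_pos_eq by lra. pose proof (Cmod_ge_0 dz). nra. }
  assert (A2 : forall z dz : C, (c <= Im z)%R -> (Cmod dz <= r)%R -> (c / 2 <= Im (z + RtoC s * dz))%R).
  { intros z dz Hz Hdz.
    replace (Im (z + RtoC s * dz)) with (Im z + s * Im dz)%R by (unfold Im, Re; simpl; ring).
    pose proof (Im_le_Cmod dz). pose proof (Rcomplements.Rabs_maj2 (Im dz)).
    pose proof (Cmod_ge_0 dz).
    assert (0 <= s * (Im dz + r))%R by (apply Rmult_le_pos; lra).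
    assert (0 <= (1 - s) * r)%R by (apply Rmult_le_pos; lra).
    lra. }
  repeat split; first [now apply A|now apply A2].
Qed.

Lemma remainder_schwartz hbar e p d : (0 < hbar)%R -> upper4 p -> upper4 (plus p d) ->
  schwartz_jet (remainder hbar e p d).
Proof.
  intros Hh Hp Hpd; destruct d as [[[t1 w1] t2] w2]; unfold remainder.
  apply schwartz_jet_plus; [now apply gauss_jet_schwartz|].
  apply schwartz_jet_scal, schwartz_jet_plus; [now apply gauss_jet_schwartz|].
  apply schwartz_jet_plus; [apply schwartz_jet_plus; [apply schwartz_jet_plus|]|];
    apply schwartz_jet_scal; now apply gauss_jet_schwartz.
Qed.

Definition pairing hbar (T : (R -> R -> C) -> C) e (p : C4) : C :=
  T (fun u1 u2 => gauss_val hbar e (env u1 u2 p)).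

Lemma tempered_remainder hbar T e p d : (0 < hbar)%R -> tempered T -> upper4 p -> upper4 (plus p d) ->
  T (remainder hbar e p d O O) = pairing hbar T e (plus p d) - pairing hbar T e p
    - paramsum d (fun x => pairing hbar T (gauss_diff hbar x e) p).
Proof.
  intros Hh HT Hp Hpd.
  assert (G : forall x, schwartz_jet (gauss_jet hbar (gauss_diff hbar x e) p)) by (intros; now apply gauss_jet_schwartz).
  assert (G1 : schwartz_jet (gauss_jet hbar e p)) by now apply gauss_jet_schwartz.
  assert (G2 : schwartz_jet (gauss_jet hbar e (plus p d))) by now apply gauss_jet_schwartz.
  destruct d as [[[t1 w1] t2] w2]; unfold remainder.
  set (J := fun x => gauss_jet hbar (gauss_diff hbar x e) p) in *.
  rewrite !tempered_plus, !tempered_scal, !tempered_plus, !tempered_scal;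
    repeat first [exact HT | exact G1 | exact G2 | apply G
                 | apply schwartz_jet_scal | apply schwartz_jet_plus].
  unfold pairing, paramsum, J. unfold gauss_jet, gauss_mix, gauss_diffn. ring.
Qed.

(** The analytic heart: the remainder is O(r^2) in each of the finitely many
    seminorms that control T, so T may be differentiated under the pairing. *)
Lemma pairing_taylor hbar T e p : (0 < hbar)%R -> tempered T -> upper4 p ->
  exists K r0, (0 < r0)%R /\ forall d r, (0 < r <= r0)%R -> (forall x, Cmod (env 0 0 d x) <= r)%R ->
    (Cmod (pairing hbar T e (plus p d) - pairing hbar T e p
       - paramsum d (fun x => pairing hbar T (gauss_diff hbar x e) p)) <= K * r ^ 2)%R.
Proof.
  intros Hh HT Hp.
  destruct (tempered_bound T HT) as [N [L [HL HTb]]].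
  destruct (upper4_region p Hp) as [c [M [Hc [HM Hr]]]].
  destruct (gauss_val_uniform_bound hbar (c / 2) (M + 1) e N Hh ltac:(lra) ltac:(lra)) as [B HB].
  exists (L * (32 * (Rabs B + 1)))%R, (Rmin 1 (c / 2)); split; [apply Rmin_glb_lt; lra|].
  intros d r [Hr0 Hr1] Hd.
  pose proof (Rmin_l 1 (c / 2)); pose proof (Rmin_r 1 (c / 2)).
  assert (HR : forall s, (0 <= s <= 1)%R -> region (c / 2) (M + 1) (pline p d s)).
  { intros s Hs; apply (region_pline c M p d r s); trivial; lra. }
  assert (Hpd : upper4 (plus p d)).
  { rewrite <- pline_1. specialize (HR 1%R ltac:(lra)). destruct (pline p d 1) as [[[t1 w1] t2] w2].
    destruct HR as (R1 & R2 & _). split; lra. }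
  rewrite <- (tempered_remainder hbar T e p d Hh HT Hp Hpd).
  pose proof (Rabs_pos B); pose proof (RRle_abs B).
  assert (0 < r ^ 2)%R by (apply pow_lt; exact Hr0).
  replace (L * (32 * (Rabs B + 1)) * r ^ 2)%R with (L * (32 * (Rabs B + 1) * r ^ 2))%R by ring.
  apply HTb.
  - now apply remainder_schwartz.
  - nra.
  - intros a b m n Ha Hb Hm Hn u1 u2.
    eapply Rle_trans.
    { apply (remainder_bound hbar e p d m n u1 u2 _ B r); [apply Rabs_pos|exact Hd|].
      intros s x y Hs. apply HB; trivial. now apply HR. }
    nra.
Qed.

(** * Complex differentiability *)

Definition cdiff {U : NormedModule C_AbsRing} (g : U -> C) (p : U) (l : U -> C) : Prop :=
  filterdiff (K := C_AbsRing) (U := U) (V := C_NormedModule) g (locally p) l.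

Lemma plus_minus_cancel {G : AbelianGroup} (p y : G) : plus p (minus y p) = y.
Proof.
  unfold minus; rewrite plus_comm, <- plus_assoc.
  exact (eq_trans (f_equal (plus y) (plus_opp_l p)) (plus_zero_r y)).
Qed.

(** Products, inverses, the exponential and the pairing with a distribution all
    have a remainder of this order. *)
Lemma cdiff_quadratic {U : NormedModule C_AbsRing} (g : U -> C) (p : U) (l : U -> C) :
  is_linear (K := C_AbsRing) (U := U) (V := C_NormedModule) l ->
  (exists K r0, (0 < r0)%R /\ forall d : U, (0 < norm d <= r0)%R ->
     (Cmod (g (plus p d) - g p - l d) <= K * norm d ^ 2)%R) ->
  cdiff g p l.
Proof.
  intros Hl [K [r0 [Hr0 H]]]; split; [exact Hl|].
  intros x Hx. apply is_filter_lim_locally_unique in Hx; subst x.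
  intros eps. apply locally_le_locally_norm.
  assert (Hr : (0 < Rmin r0 (eps / (Rabs K + 1)))%R).
  { pose proof (Rabs_pos K). apply Rmin_glb_lt; [exact Hr0|].
    apply Rdiv_lt_0_compat; [apply cond_pos|lra]. }
  exists (mkposreal _ Hr); intros y Hy; unfold ball_norm in Hy; simpl in Hy.
  assert (Ey : y = plus p (minus y p))
    by exact (eq_sym (plus_minus_cancel (G := NormedModule.AbelianGroup _ U) p y)).
  revert Hy Ey; generalize (minus y p : U); intros d Hd Ey; subst y.
  change (Cmod (g (plus p d) - g p - l d) <= eps * norm d)%R.
  pose proof (norm_ge_0 d) as Hd0.
  destruct (Req_dec (norm d) 0) as [E|E].
  - apply norm_eq_zero in E; subst d. rewrite plus_zero_r.
    replace (l zero) with (RtoC 0) by (symmetry; apply (linear_zero l Hl)).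
    replace (g p - g p - 0) with (RtoC 0) by ring. rewrite Cmod_0.
    apply Rmult_le_pos; [left; apply cond_pos|exact Hd0].
  - pose proof (Rmin_l r0 (eps / (Rabs K + 1))); pose proof (Rmin_r r0 (eps / (Rabs K + 1))).
    eapply Rle_trans; [apply H; lra|].
    pose proof (RRle_abs K); pose proof (Rabs_pos K).
    assert (norm d * (Rabs K + 1) <= eps)%R.
    { apply (Rmult_le_reg_r (/ (Rabs K + 1))); [apply Rinv_0_lt_compat; lra|].
      rewrite Rmult_assoc, Rinv_r by lra. unfold Rdiv in *; lra. }
    simpl. assert (K * norm d <= eps)%R by nra. nra.
Qed.

Lemma cdiff_eq {U : NormedModule C_AbsRing} (g : U -> C) p l l' :
  cdiff g p l -> (forall d, l d = l' d) -> cdiff g p l'.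
Proof. intros H E; eapply filterdiff_ext_lin; [exact H|exact E]. Qed.

Lemma cdiff_const {U : NormedModule C_AbsRing} (c : C) (p : U) : cdiff (fun _ => c) p (fun _ => RtoC 0).
Proof. apply (filterdiff_const (V := C_NormedModule)). Qed.

Lemma cdiff_plus {U : NormedModule C_AbsRing} (f g : U -> C) p lf lg :
  cdiff f p lf -> cdiff g p lg -> cdiff (fun y => f y + g y) p (fun d => lf d + lg d).
Proof. intros Hf Hg. exact (filterdiff_plus_fct (V := C_NormedModule) f g lf lg Hf Hg). Qed.

Lemma filterdiff_pairC {U V W : NormedModule C_AbsRing} (f : U -> V) (g : U -> W) p lf lg :
  filterdiff f (locally p) lf -> filterdiff g (locally p) lg ->
  filterdiff (fun y => (f y, g y) : prod_NormedModule C_AbsRing V W) (locally p)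
    (fun d => (lf d, lg d) : prod_NormedModule C_AbsRing V W).
Proof.
  intros Hf Hg.
  apply (filterdiff_comp'_2 (W := prod_NormedModule C_AbsRing V W) f g (fun a b => (a, b)) p lf lg (fun a b => (a, b)) Hf Hg).
  apply (filterdiff_ext_lin _ (fun t => t)); [|intros [a b]; reflexivity].
  apply (filterdiff_ext (fun t => t)); [intros [a b]; reflexivity|].
  apply filterdiff_id.
Qed.

Lemma cdiff_mult {U : NormedModule C_AbsRing} (f g : U -> C) p lf lg :
  cdiff f p lf -> cdiff g p lg -> cdiff (fun y => f y * g y) p (fun d => lf d * g p + f p * lg d).
Proof.
  intros Hf Hg.
  apply (filterdiff_comp'_2 (U := C_NormedModule) (V := C_NormedModule) (W := C_NormedModule)
    f g (fun a b => a * b) p lf lg (fun a b => a * g p + f p * b) Hf Hg).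
  apply (cdiff_quadratic (U := prod_NormedModule C_AbsRing C_NormedModule C_NormedModule)
    (fun t => fst t * snd t) (f p, g p) (fun t => fst t * g p + f p * snd t)).
  - split.
    + intros [a b] [c d]; simpl; unfold plus; simpl; ring.
    + intros k [a b]; simpl; unfold scal; simpl; unfold mult; simpl; ring.
    + exists (Cmod (g p) + Cmod (f p) + 1)%R; split.
      * pose proof (Cmod_ge_0 (g p)); pose proof (Cmod_ge_0 (f p)); lra.
      * intros [a b]. simpl fst; simpl snd.
        change (Cmod (a * g p + f p * b) <= (Cmod (g p) + Cmod (f p) + 1) * norm (a, b))%R.
        destruct (norm_prod (K := C_AbsRing) (U := C_NormedModule) (V := C_NormedModule) a b) as [Hn _].
        pose proof (Rmax_l (norm a) (norm b)); pose proof (Rmax_r (norm a) (norm b)).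
        change (norm a) with (Cmod a) in *; change (norm b) with (Cmod b) in *.
        eapply Rle_trans; [apply Cmod_triangle|]. rewrite !Cmod_mult.
        pose proof (Cmod_ge_0 (g p)); pose proof (Cmod_ge_0 (f p)); pose proof (Cmod_ge_0 a); pose proof (Cmod_ge_0 b).
        nra.
  - exists 1%R, 1%R; split; [lra|]. intros [a b] _.
    destruct (norm_prod (K := C_AbsRing) (U := C_NormedModule) (V := C_NormedModule) a b) as [Hn _].
    pose proof (Rmax_l (norm a) (norm b)); pose proof (Rmax_r (norm a) (norm b)).
    change (norm a) with (Cmod a) in *; change (norm b) with (Cmod b) in *.
    match goal with |- (Cmod ?z <= _)%R => replace z with (a * b) end.
    2: { simpl; unfold plus; simpl; ring. }
    rewrite Cmod_mult. pose proof (Cmod_ge_0 a); pose proof (Cmod_ge_0 b). nra.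
Qed.

Lemma cdiff_comp {U V : NormedModule C_AbsRing} (f : U -> V) (g : V -> C) p (lf : U -> V) (lg : V -> C) :
  filterdiff f (locally p) lf -> cdiff g (f p) lg -> cdiff (fun y => g (f y)) p (fun d => lg (lf d)).
Proof. intros Hf Hg. exact (filterdiff_comp' (W := C_NormedModule) f g p lf lg Hf Hg). Qed.

(** One-variable complex differentiability over C_NormedModule, the module from
    which C2, C3 and C4 are built; its uniform structure (the product one) is
    not the one of C as an AbsRing over which is_derive is stated. *)
Definition cder (g : C -> C) (z l : C) : Prop :=
  cdiff (U := C_NormedModule) g z (fun h => h * l).

Lemma is_linear_Cmult (l : C) :
  is_linear (K := C_AbsRing) (U := C_NormedModule) (V := C_NormedModule) (fun h => h * l).
Proof.
  split.
  - intros a b; unfold plus; simpl; ring.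
  - intros k a; unfold scal; simpl; unfold mult; simpl; ring.
  - exists (Cmod l + 1)%R; split; [pose proof (Cmod_ge_0 l); lra|].
    intros h. change (Cmod (h * l) <= (Cmod l + 1) * Cmod h)%R. rewrite Cmod_mult.
    pose proof (Cmod_ge_0 h); nra.
Qed.

Lemma cder_quadratic (g : C -> C) (z l : C) :
  (exists K r0, (0 < r0)%R /\ forall h, (0 < Cmod h <= r0)%R ->
     (Cmod (g (z + h)%C - g z - h * l) <= K * Cmod h ^ 2)%R) ->
  cder g z l.
Proof. intros H; apply cdiff_quadratic; [apply is_linear_Cmult|exact H]. Qed.

Lemma Cinv_cder (z : C) : z <> 0 -> cder Cinv z (- (/ z * / z)).
Proof.
  intros Hz; apply cder_quadratic.
  assert (Hz' : (0 < Cmod z)%R) by exact (proj1 (Cmod_gt_0 z) Hz).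
  exists (2 / Cmod z ^ 3)%R, (Cmod z / 2)%R; split; [lra|]. intros h [Hh0 Hh].
  assert (Hzh : (Cmod z / 2 <= Cmod (z + h))%R).
  { pose proof (Cmod_triangle (z + h) (- h)) as T. rewrite Cmod_opp in T.
    replace (z + h + - h) with z in T by ring. lra. }
  assert (Hzh0 : z + h <> 0) by (apply (proj2 (Cmod_gt_0 (z + h))); lra).
  replace (/ (z + h) - / z - h * - (/ z * / z)) with (h * h * / (z * z * (z + h))).
  2: { field; split; assumption. }
  rewrite !Cmod_mult, Cmod_inv, !Cmod_mult.
  2: { apply Cmult_neq_0; [apply Cmult_neq_0|]; assumption. }
  assert (Hi : (/ (Cmod z * Cmod z * Cmod (z + h)) <= 2 / Cmod z ^ 3)%R).
  { replace (2 / Cmod z ^ 3)%R with (/ (Cmod z * Cmod z * (Cmod z / 2)))%R by (field; lra).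
    apply Rinv_le_contravar; [|apply Rmult_le_compat_l; nra].
    repeat apply Rmult_lt_0_compat; lra. }
  replace (2 / Cmod z ^ 3 * Cmod h ^ 2)%R with (Cmod h * Cmod h * (2 / Cmod z ^ 3))%R by (simpl; field; lra).
  apply Rmult_le_compat_l; [nra|exact Hi].
Qed.

Lemma Cexp_cder z : cder Cexp z (Cexp z).
Proof.
  apply cder_quadratic. exists (2 * exp (Re z + 1))%R, 1%R; split; [lra|]. intros h [_ Hh].
  replace (Cexp (z + h) - Cexp z - h * Cexp z) with
    (Cexp (z + RtoC 1 * h) - Cexp (z + RtoC 0 * h) - h * Cexp (z + RtoC 0 * h))
    by (replace (z + RtoC 1 * h) with (z + h) by ring; replace (z + RtoC 0 * h) with z by ring; reflexivity).
  (* Taylor along the segment from z to z + h, where |exp| is at most exp(Re z + 1) *)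
  assert (H : (1 * Cmod (Cexp (z + RtoC 1 * h) - Cexp (z + RtoC 0 * h) - h * Cexp (z + RtoC 0 * h))
     <= 2 * (exp (Re z + 1) * Cmod h ^ 2))%R).
  { assert (D : forall s, rderive (fun s => Cexp (z + RtoC s * h)) s (h * Cexp (z + RtoC s * h))).
    { intros s; apply rderive_Cexp, rderive_affine. }
    apply (taylor_complex (fun s => Cexp (z + RtoC s * h)) (fun s => h * Cexp (z + RtoC s * h))
      (fun s => h * (h * Cexp (z + RtoC s * h)))).
    - exact D.
    - intros s; eapply rderive_eq; [apply rderive_mult; [apply rderive_const|apply D]|]. cbv beta; ring.
    - lra.
    - intros s Hs. rewrite !Cmod_mult, Cmod_Cexp.
      assert (He : (exp (Re (z + RtoC s * h)) <= exp (Re z + 1))%R).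
      { replace (Re (z + RtoC s * h)) with (Re z + s * Re h)%R by (unfold Re, Im; simpl; ring).
        pose proof (re_le_Cmod h). pose proof (RRle_abs (Re h)).
        assert (s * Re h <= 1)%R by nra.
        destruct (Rle_lt_or_eq_dec (s * Re h) 1) as [L|L]; [assumption| |].
        - left; apply exp_increasing; lra.
        - right; f_equal; lra. }
      pose proof (Cmod_ge_0 h).
      replace (1 * (Cmod h * (Cmod h * exp (Re (z + RtoC s * h)))))%R with
        (exp (Re (z + RtoC s * h)) * Cmod h ^ 2)%R by ring.
      apply Rmult_le_compat_r; [apply pow2_ge_0|exact He]. }
  lra.
Qed.

Lemma cder_eps g z l : cder g z l -> forall eps, (0 < eps)%R -> exists delta, (0 < delta)%R /\
  forall h, (Cmod h < delta)%R -> (Cmod (g (z + h)%C - g z - h * l) <= eps * Cmod h)%R.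
Proof.
  intros [_ H] eps He.
  specialize (H z (fun P HP => HP) (mkposreal eps He)).
  apply (locally_norm_le_locally (V := C_NormedModule)) in H.
  destruct H as [delta H]; exists delta; split; [apply cond_pos|].
  intros h Hh.
  assert (H' : forall y : C, (Cmod (y - z) < delta)%R ->
    (Cmod (g y - g z - (y - z) * l) <= eps * Cmod (y - z))%R) by exact H.
  specialize (H' (z + h)). replace (z + h - z) with h in H' by ring. exact (H' Hh).
Qed.

(** The passage from one uniform structure on C to the other, made once here by
    means of the modulus. *)
Lemma cder_C_derive g z l : cder g z l -> C_derive g z = l.
Proof.
  intros H; apply is_C_derive_unique. split.
  - apply (is_linear_scal_l (K := C_AbsRing) (V := C_NormedModule)).
  - intros x Hx. apply (is_filter_lim_locally_unique (V := AbsRing_NormedModule C_AbsRing)) in Hx; subst x.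
    intros eps. destruct (cder_eps g z l H eps (cond_pos eps)) as [delta [Hd HH]].
    exists (mkposreal delta Hd).
    assert (HK : forall y : C, (Cmod (y - z) < delta)%R ->
      (Cmod (g y - g z - (y - z) * l) <= eps * Cmod (y - z))%R); [|exact HK].
    intros y Hy. specialize (HH (y - z) Hy).
    replace (z + (y - z)) with y in HH by ring. exact HH.
Qed.

Lemma cder_eq g z l l' : cder g z l -> l = l' -> cder g z l'.
Proof. intros H <-; exact H. Qed.

Lemma cder_intro (g l0 : C -> C) z l :
  cdiff (U := C_NormedModule) g z l0 -> (forall h : C, l0 h = h * l) -> cder g z l.
Proof. intros H E; exact (cdiff_eq _ _ _ _ H E). Qed.

Lemma cder_const c z : cder (fun _ => c) z 0.
Proof. eapply cder_intro; [apply cdiff_const|]. intros; simpl; ring. Qed.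

Lemma cder_id z : cder (fun y => y) z 1.
Proof.
  eapply cder_intro; [apply (filterdiff_id (K := C_AbsRing) (V := C_NormedModule))|]. intros; simpl; ring.
Qed.

Lemma cder_plus f g z l m : cder f z l -> cder g z m -> cder (fun y => f y + g y) z (l + m).
Proof. intros Hf Hg; eapply cder_intro; [exact (cdiff_plus _ _ _ _ _ Hf Hg)|]. intros; simpl; ring. Qed.

Lemma cder_mult f g z l m :
  cder f z l -> cder g z m -> cder (fun y => f y * g y) z (l * g z + f z * m).
Proof. intros Hf Hg; eapply cder_intro; [exact (cdiff_mult _ _ _ _ _ Hf Hg)|]. intros; simpl; ring. Qed.

Lemma cder_comp f g z l m : cder f z l -> cder g (f z) m -> cder (fun y => g (f y)) z (l * m).
Proof.
  intros Hf Hg; eapply cder_intro.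
  - exact (cdiff_comp (U := C_NormedModule) (V := C_NormedModule) f g z _ _ Hf Hg).
  - intros; simpl; ring.
Qed.

Lemma cder_ext f g z l : (forall y, f y = g y) -> cder f z l -> cder g z l.
Proof. intros E H; eapply filterdiff_ext; [exact E|exact H]. Qed.

Lemma cder_ext_near f g z l r : (0 < r)%R -> (forall h, (Cmod h < r)%R -> f (z + h)%C = g (z + h)%C) ->
  cder f z l -> cder g z l.
Proof.
  intros Hr E H; refine (filterdiff_ext_locally _ _ _ _ _ H).
  apply (locally_le_locally_norm (V := C_NormedModule)).
  exists (mkposreal r Hr).
  assert (HK : forall y : C, (Cmod (y - z) < r)%R -> f y = g y); [|exact HK].
  intros y Hy; specialize (E (y - z) Hy).
  replace (z + (y - z)) with y in E by ring. exact E.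
Qed.

(** The complex derivative vanishes, hence so do the derivatives of the real and
    imaginary parts along the segment. *)
Lemma cder_zero_segment g a b :
  (forall s, (0 <= s <= 1)%R -> cder g (a + RtoC s * (b - a)) 0) -> g a = g b.
Proof.
  intros H.
  set (phi := fun s : R => g (a + RtoC s * (b - a))).
  assert (D : forall s, (0 <= s <= 1)%R ->
    is_derive (fun t => Re (phi t)) s 0 /\ is_derive (fun t => Im (phi t)) s 0).
  { intros s Hs.
    assert (E : forall eps, (0 < eps)%R -> exists delta : posreal, forall h, h <> 0%R -> (Rabs h < delta)%R ->
       (Cmod (phi (s + h)%R - phi s) < eps * Rabs h)%R).
    { intros eps He.
      pose proof (Cmod_ge_0 (b - a)) as Hc.
      destruct (cder_eps _ _ _ (H s Hs) (eps / (2 * (Cmod (b - a) + 1)))) as [delta [Hd HH]].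
      { apply Rdiv_lt_0_compat; lra. }
      assert (Hd' : (0 < delta / (Cmod (b - a) + 1))%R) by (apply Rdiv_lt_0_compat; lra).
      exists (mkposreal _ Hd'); intros h Hh0 Hh; simpl in Hh.
      pose proof (Rabs_pos_lt h Hh0) as Hp.
      specialize (HH (RtoC h * (b - a))). rewrite Cmod_mult, Cmod_R in HH.
      assert (Hl : (Rabs h * Cmod (b - a) < delta)%R).
      { apply (Rmult_lt_compat_r (Cmod (b - a) + 1)) in Hh; [|lra].
        unfold Rdiv in Hh; rewrite Rmult_assoc, Rinv_l in Hh by lra. nra. }
      specialize (HH Hl).
      replace (phi (s + h)%R - phi s) with
        (g (a + RtoC s * (b - a) + RtoC h * (b - a)) - g (a + RtoC s * (b - a)) - RtoC h * (b - a) * 0).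
      2: { unfold phi. rewrite RtoC_plus. replace (a + (RtoC s + RtoC h) * (b - a)) with (a + RtoC s * (b - a) + RtoC h * (b - a)) by ring. ring. }
      eapply Rle_lt_trans; [exact HH|].
      replace (eps / (2 * (Cmod (b - a) + 1)) * (Rabs h * Cmod (b - a)))%R
        with (eps * Rabs h * (Cmod (b - a) / (2 * (Cmod (b - a) + 1))))%R by (field; lra).
      rewrite <- (Rmult_1_r (eps * Rabs h)) at 2.
      apply Rmult_lt_compat_l; [now apply Rmult_lt_0_compat|].
      apply (Rmult_lt_reg_r (2 * (Cmod (b - a) + 1))); [lra|].
      unfold Rdiv; rewrite Rmult_assoc, Rinv_l by lra. lra. }
    split; apply is_derive_Reals; intros eps He; destruct (E eps He) as [delta HE];
      exists delta; intros h Hh0 Hh; specialize (HE h Hh0 Hh); pose proof (Rabs_pos_lt h Hh0);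
      rewrite Rminus_0_r; unfold Rdiv; rewrite Rabs_mult, Rabs_inv;
      apply (Rmult_lt_reg_r (Rabs h)); trivial; rewrite Rmult_assoc, Rinv_l, Rmult_1_r by lra;
      (eapply Rle_lt_trans; [|exact HE]).
    - replace (Re (phi (s + h)%R) - Re (phi s))%R with (Re (phi (s + h)%R - phi s))
        by (unfold Re, Im; simpl; ring). apply re_le_Cmod.
    - replace (Im (phi (s + h)%R) - Im (phi s))%R with (Im (phi (s + h)%R - phi s))
        by (unfold Re, Im; simpl; ring). apply Im_le_Cmod. }
  assert (E : phi 0%R = phi 1%R).
  { apply C_eq.
    - apply (eq_is_derive (fun t => Re (phi t))); [intros t Ht; apply D; exact Ht|lra].
    - apply (eq_is_derive (fun t => Im (phi t))); [intros t Ht; apply D; exact Ht|lra]. }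
  unfold phi in E.
  replace (a + RtoC 0 * (b - a)) with a in E by ring.
  replace (a + RtoC 1 * (b - a)) with b in E by ring. exact E.
Qed.

Lemma cdiff_inv {U : NormedModule C_AbsRing} (f : U -> C) p lf :
  cdiff f p lf -> f p <> 0 -> cdiff (fun y => / f y) p (fun d => lf d * (- (/ f p * / f p))).
Proof.
  intros Hf Hp. exact (cdiff_comp (V := C_NormedModule) f Cinv p lf _ Hf (Cinv_cder (f p) Hp)).
Qed.

Lemma Im_pos_near (a : C -> C) z a' : cder a z a' -> (0 < Im (a z))%R ->
  exists r, (0 < r)%R /\ forall h, (Cmod h < r)%R -> (0 < Im (a (z + h)%C))%R.
Proof.
  intros Ha Ia.
  destruct (cder_eps a z a' Ha 1 ltac:(lra)) as [delta [Hd H]].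
  pose proof (Cmod_ge_0 a').
  exists (Rmin delta (Im (a z) / (Cmod a' + 1))); split.
  { apply Rmin_glb_lt; [exact Hd|]. apply Rdiv_lt_0_compat; lra. }
  intros h Hh.
  pose proof (Rmin_l delta (Im (a z) / (Cmod a' + 1))).
  pose proof (Rmin_r delta (Im (a z) / (Cmod a' + 1))).
  specialize (H h ltac:(lra)).
  assert (H3 : (Cmod h * (Cmod a' + 1) < Im (a z))%R).
  { apply (Rmult_lt_reg_r (/ (Cmod a' + 1))); [apply Rinv_0_lt_compat; lra|].
    rewrite Rmult_assoc, Rinv_r by lra. unfold Rdiv in *; lra. }
  assert (H4 : (Cmod (a (z + h)%C - a z) <= Cmod h * (Cmod a' + 1))%R).
  { replace (a (z + h) - a z) with ((a (z + h) - a z - h * a') + h * a') by ring.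
    eapply Rle_trans; [apply Cmod_triangle|]. rewrite Cmod_mult; lra. }
  pose proof (Im_le_Cmod (a (z + h) - a z)) as H5.
  replace (Im (a (z + h) - a z)) with (Im (a (z + h)%C) - Im (a z))%R in H5 by (unfold Im; simpl; ring).
  pose proof (Rcomplements.Rabs_maj2 (Im (a (z + h)%C) - Im (a z))). lra.
Qed.

Lemma Im_pos_neq0 (w : C) : (0 < Im w)%R -> w <> 0.
Proof. intros H ->; simpl in H; lra. Qed.

Lemma Im_neg_neq0 (z : C) : (Im z < 0)%R -> z <> 0.
Proof. intros H ->; simpl in H; lra. Qed.

Lemma Im_Cinv_pos (z : C) : (Im z < 0)%R -> (0 < Im (/ z))%R.
Proof.
  destruct z as [x y]; simpl; intros H. apply Rdiv_lt_0_compat; [lra|]. nra.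
Qed.

Lemma Im_Cinv_neg (z : C) : (0 < Im z)%R -> (Im (/ z) < 0)%R.
Proof.
  destruct z as [x y]; simpl; intros H.
  assert (0 < y / (x * (x * 1) + y * (y * 1)))%R by (apply Rdiv_lt_0_compat; nra).
  unfold Rdiv in *; lra.
Qed.

(** * The pairing of a Helmholtz solution with Gaussians *)

Lemma norm_fst_le {U V : NormedModule C_AbsRing} (x : prod_NormedModule C_AbsRing U V) :
  (norm (fst x) <= norm x)%R.
Proof. destruct x as [u v]; eapply Rle_trans; [apply Rmax_l|apply norm_prod]. Qed.

Lemma norm_snd_le {U V : NormedModule C_AbsRing} (x : prod_NormedModule C_AbsRing U V) :
  (norm (snd x) <= norm x)%R.
Proof. destruct x as [u v]; eapply Rle_trans; [apply Rmax_r|apply norm_prod]. Qed.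

Lemma env_norm (d : C4) x : (Cmod (env 0 0 d x) <= norm d)%R.
Proof.
  pose proof (norm_fst_le (U := C3) (V := C_NormedModule) d) as N3.
  pose proof (norm_snd_le (U := C3) (V := C_NormedModule) d) as M3.
  pose proof (norm_fst_le (U := C2) (V := C_NormedModule) (fst d)) as N2.
  pose proof (norm_snd_le (U := C2) (V := C_NormedModule) (fst d)) as M2.
  pose proof (norm_fst_le (U := C_NormedModule) (V := C_NormedModule) (fst (fst d))) as N1.
  pose proof (norm_snd_le (U := C_NormedModule) (V := C_NormedModule) (fst (fst d))) as M1.
  assert (H0 : (Cmod 0 <= norm d)%R) by (rewrite Cmod_0; apply norm_ge_0).
  pose proof (Rle_trans _ _ _ N2 N3) as N2'. pose proof (Rle_trans _ _ _ M2 N3) as M2'.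
  pose proof (Rle_trans _ _ _ N1 N2') as N1'. pose proof (Rle_trans _ _ _ M1 N2') as M1'.
  destruct d as [[[t1 w1] t2] w2].
  destruct x; [exact H0|exact H0|exact M1'|exact N1'|exact M3|exact M2'].
Qed.

Lemma paramsum_linear (F : coord -> C) :
  is_linear (K := C_AbsRing) (U := C4) (V := C_NormedModule) (fun d => paramsum d F).
Proof.
  split.
  - intros [[[t1 w1] t2] w2] [[[t1' w1'] t2'] w2'].
    change ((t1 + t1') * F T1 + (w1 + w1') * F W1 + (t2 + t2') * F T2 + (w2 + w2') * F W2 =
      t1 * F T1 + w1 * F W1 + t2 * F T2 + w2 * F W2 +
      (t1' * F T1 + w1' * F W1 + t2' * F T2 + w2' * F W2)).
    ring.
  - intros k [[[t1 w1] t2] w2].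
    change ((k * t1) * F T1 + (k * w1) * F W1 + (k * t2) * F T2 + (k * w2) * F W2 =
      k * (t1 * F T1 + w1 * F W1 + t2 * F T2 + w2 * F W2)).
    ring.
  - destruct (coord_uniform (fun x B => (Cmod (F x) <= B)%R)) as [B HB].
    + intros; eapply Rle_trans; eassumption.
    + intros x; exists (Cmod (F x)); lra.
    + pose proof (HB T1); pose proof (Cmod_ge_0 (F T1)).
      exists (4 * B + 1)%R; split; [lra|]. intros d.
      pose proof (paramsum_bound d F (norm d) B (env_norm d) HB) as H1.
      pose proof (norm_ge_0 d).
      change (Cmod (paramsum d F) <= (4 * B + 1) * norm d)%R. lra.
Qed.

Definition unit_expr : poly_expr := PC 1.

(** Written as a real constant so that real and imaginary parts compute. *)
Definition half : C := RtoC (/ 2).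

Lemma half_eq : half = / 2.
Proof. unfold half; rewrite RtoC_inv; [reflexivity|lra]. Qed.

(** With m + s/2 = 1/w1 and m - s/2 = 1/w2 this says that Im w_j > 0. *)
Definition below (s m : C) : Prop := (Im (m + half * s) < 0 /\ Im (m - half * s) < 0)%R.

Definition base_point (N : R) : C := - (Ci * RtoC N).

Lemma below_base_point s N : (Cmod s < N)%R -> below s (base_point N).
Proof.
  intros H. pose proof (Im_le_Cmod s). pose proof (RRle_abs (Im s)).
  pose proof (Rcomplements.Rabs_maj2 (Im s)). pose proof (Cmod_ge_0 s).
  unfold below, base_point, half. unfold Im, Re in *; simpl in *. split; lra.
Qed.

Section Metamorphism.

Context (hbar : R) (hbar_gt0 : (0 < hbar)%R) (T : (R -> R -> C) -> C) (T_tempered : tempered T).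

Lemma pairing_cdiff e (p : C4) : upper4 p ->
  cdiff (pairing hbar T e) p (fun d => paramsum d (fun x => pairing hbar T (gauss_diff hbar x e) p)).
Proof.
  intros Hp; apply cdiff_quadratic; [apply paramsum_linear|].
  destruct (pairing_taylor hbar T e p hbar_gt0 T_tempered Hp) as [K [r0 [Hr0 H]]].
  exists K, r0; split; [exact Hr0|]. intros d Hd. apply H; [exact Hd|apply env_norm].
Qed.

Lemma pairing_cdiff_comp {U : NormedModule C_AbsRing} e (a b c d : U -> C) p la lb lc ld :
  cdiff a p la -> cdiff b p lb -> cdiff c p lc -> cdiff d p ld ->
  (0 < Im (b p))%R -> (0 < Im (d p))%R ->
  cdiff (fun y => pairing hbar T e (a y, b y, c y, d y)) p
    (fun h => paramsum (la h, lb h, lc h, ld h)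
       (fun x => pairing hbar T (gauss_diff hbar x e) (a p, b p, c p, d p))).
Proof.
  intros Ha Hb Hc Hd Ib Id.
  pose proof (filterdiff_pairC (V := C_NormedModule) (W := C_NormedModule) a b p la lb Ha Hb) as H2.
  pose proof (filterdiff_pairC (V := C2) (W := C_NormedModule) _ c p _ lc H2 Hc) as H3.
  pose proof (filterdiff_pairC (V := C3) (W := C_NormedModule) _ d p _ ld H3 Hd) as H4.
  refine (cdiff_comp (V := C4) (fun y => (a y, b y, c y, d y)) (pairing hbar T e) p
    (fun h => (la h, lb h, lc h, ld h)) (fun v => paramsum v
       (fun x => pairing hbar T (gauss_diff hbar x e) (a p, b p, c p, d p))) H4 _).
  apply pairing_cdiff. split; assumption.
Qed.

Lemma pairing_cder e (a b c d : C -> C) z a' b' c' d' :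
  cder a z a' -> cder b z b' -> cder c z c' -> cder d z d' ->
  (0 < Im (b z))%R -> (0 < Im (d z))%R ->
  cder (fun y => pairing hbar T e (a y, b y, c y, d y)) z
    (paramsum (a', b', c', d') (fun x => pairing hbar T (gauss_diff hbar x e) (a z, b z, c z, d z))).
Proof.
  intros Ha Hb Hc Hd Ib Id.
  eapply cder_intro.
  - exact (pairing_cdiff_comp (U := C_NormedModule) e a b c d z _ _ _ _ Ha Hb Hc Hd Ib Id).
  - intros h; simpl; ring.
Qed.

Lemma pairing_linear2 e f g c1 c2 (p : C4) : upper4 p ->
  (forall u1 u2, gauss_val hbar e (env u1 u2 p) =
     c1 * gauss_val hbar f (env u1 u2 p) + c2 * gauss_val hbar g (env u1 u2 p)) ->
  pairing hbar T e p = c1 * pairing hbar T f p + c2 * pairing hbar T g p.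
Proof.
  intros Hp E.
  transitivity (T (jet_plus (jet_scal c1 (gauss_jet hbar f p)) (jet_scal c2 (gauss_jet hbar g p)) O O)).
  - unfold pairing; f_equal.
    apply functional_extensionality; intros u1; apply functional_extensionality; intros u2.
    apply E.
  - rewrite tempered_plus, !tempered_scal; trivial;
      repeat apply schwartz_jet_scal; now apply gauss_jet_schwartz.
Qed.

(** The kernel w^(1/2) exp(alpha w (u - t)^2) solves the heat equation in t with
    time 1/w; this is that identity before the factor w^(1/2) is included. *)
Lemma pairing_heat1 (t1 w1 t2 w2 : C) : (0 < Im w1)%R -> (0 < Im w2)%R ->
  pairing hbar T (gauss_diff hbar T1 (gauss_diff hbar T1 unit_expr)) (t1, w1, t2, w2) =
  4 * alpha hbar * (w1 * w1) * pairing hbar T (gauss_diff hbar W1 unit_expr) (t1, w1, t2, w2)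
  + 2 * alpha hbar * w1 * pairing hbar T unit_expr (t1, w1, t2, w2).
Proof.
  intros; apply pairing_linear2; [now split|]. intros; unfold gauss_val; simpl. ring.
Qed.

Lemma pairing_heat2 (t1 w1 t2 w2 : C) : (0 < Im w1)%R -> (0 < Im w2)%R ->
  pairing hbar T (gauss_diff hbar T2 (gauss_diff hbar T2 unit_expr)) (t1, w1, t2, w2) =
  4 * alpha hbar * (w2 * w2) * pairing hbar T (gauss_diff hbar W2 unit_expr) (t1, w1, t2, w2)
  + 2 * alpha hbar * w2 * pairing hbar T unit_expr (t1, w1, t2, w2).
Proof.
  intros; apply pairing_linear2; [now split|]. intros; unfold gauss_val; simpl. ring.
Qed.

Context (k : R) (T_helmholtz : helmholtz k T).

(** The Gaussian depends on u_j - t_j only, so second derivatives in t_j equal those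
    in u_j, and the latter can be thrown onto the distribution. *)
Lemma pairing_helmholtz (t1 w1 t2 w2 : C) : (0 < Im w1)%R -> (0 < Im w2)%R ->
  pairing hbar T (gauss_diff hbar T1 (gauss_diff hbar T1 unit_expr)) (t1, w1, t2, w2)
  + pairing hbar T (gauss_diff hbar T2 (gauss_diff hbar T2 unit_expr)) (t1, w1, t2, w2)
  + RtoC (k ^ 2) * pairing hbar T unit_expr (t1, w1, t2, w2) = 0.
Proof.
  intros H1 H2.
  set (p := (t1, w1, t2, w2) : C4).
  assert (Hp : upper4 p) by now split.
  pose proof (T_helmholtz _ (schwartz_jet_schwartz _ (gauss_jet_schwartz hbar unit_expr p hbar_gt0 Hp))) as H.
  unfold dist_d1, dist_d2 in H.
  rewrite !(is_jet_cpartial _ _ _ (gauss_jet_is_jet hbar unit_expr p)) in H.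
  change (gauss_jet hbar unit_expr p 1%nat 0%nat) with (gauss_jet hbar (gauss_diff hbar U1 unit_expr) p 0%nat 0%nat) in H.
  change (gauss_jet hbar unit_expr p 0%nat 1%nat) with (gauss_jet hbar (gauss_diff hbar U2 unit_expr) p 0%nat 0%nat) in H.
  rewrite !(is_jet_cpartial _ _ _ (gauss_jet_is_jet hbar _ p)) in H.
  rewrite <- H; clear H.
  replace (pairing hbar T (gauss_diff hbar T1 (gauss_diff hbar T1 unit_expr)) p)
    with (T (gauss_jet hbar (gauss_diff hbar U1 unit_expr) p 1%nat 0%nat)).
  2: { unfold pairing; f_equal.
    apply functional_extensionality; intros u1; apply functional_extensionality; intros u2.
    unfold gauss_jet, gauss_val; simpl; ring. }
  replace (pairing hbar T (gauss_diff hbar T2 (gauss_diff hbar T2 unit_expr)) p)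
    with (T (gauss_jet hbar (gauss_diff hbar U2 unit_expr) p 0%nat 1%nat)).
  2: { unfold pairing; f_equal.
    apply functional_extensionality; intros u1; apply functional_extensionality; intros u2.
    unfold gauss_jet, gauss_val; simpl; ring. }
  change (pairing hbar T unit_expr p) with (T (gauss_jet hbar unit_expr p 0%nat 0%nat)).
  ring.
Qed.

Context (sq : C2 -> C) (sq_branch : sqrt_branch sq).

Lemma sq_cdiff_comp {U : NormedModule C_AbsRing} (a b : U -> C) p la lb :
  cdiff a p la -> cdiff b p lb -> (0 < Im (a p))%R -> (0 < Im (b p))%R ->
  exists l, cdiff (fun y => sq (a y, b y)) p l.
Proof.
  intros Ha Hb Ia Ib.
  destruct (proj1 sq_branch (a p, b p) (conj Ia Ib)) as [l Hl].
  eexists; refine (cdiff_comp (V := C2) (fun y => (a y, b y)) sq p _ l _ Hl).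
  exact (filterdiff_pairC (V := C_NormedModule) (W := C_NormedModule) a b p la lb Ha Hb).
Qed.

Lemma sq_neq0 w1 w2 : (0 < Im w1)%R -> (0 < Im w2)%R -> sq (w1, w2) <> 0.
Proof.
  intros H1 H2 E. pose proof (proj2 sq_branch w1 w2 (conj H1 H2)) as H.
  rewrite E, Cmult_0_l in H. symmetry in H.
  apply (Cmult_neq_0 w1 w2); auto using Im_pos_neq0.
Qed.

(** Any branch has the same logarithmic derivative, because sq^2 = w1 w2. *)
Lemma sq_cder (a b : C -> C) z a' b' :
  cder a z a' -> cder b z b' -> (0 < Im (a z))%R -> (0 < Im (b z))%R ->
  cder (fun y => sq (a y, b y)) z (sq (a z, b z) * ((a' / a z + b' / b z) / 2)).
Proof.
  intros Ha Hb Ia Ib.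
  destruct (sq_cdiff_comp (U := C_NormedModule) a b z _ _ Ha Hb Ia Ib) as [l Hl].
  (* the derivative l 1 is found by differentiating sq^2 = a b near z *)
  assert (H : cder (fun y => sq (a y, b y)) z (l (RtoC 1))).
  { eapply cder_intro; [exact Hl|]. intros h.
    pose proof (linear_scal l (proj1 Hl) h (RtoC 1)) as E.
    change (l (h * 1)%C = h * l (RtoC 1)) in E. rewrite <- E. f_equal; ring. }
  eapply cder_eq; [exact H|].
  pose proof (cder_mult _ _ _ _ _ H H) as H2.
  destruct (Im_pos_near a z a' Ha Ia) as [r1 [Hr1 P1]].
  destruct (Im_pos_near b z b' Hb Ib) as [r2 [Hr2 P2]].
  assert (H3 : cder (fun y => a y * b y) z (l (RtoC 1) * sq (a z, b z) + sq (a z, b z) * l (RtoC 1))).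
  { refine (cder_ext_near _ _ _ _ (Rmin r1 r2) _ _ H2); [now apply Rmin_glb_lt|].
    intros h Hh; cbv beta. pose proof (Rmin_l r1 r2); pose proof (Rmin_r r1 r2).
    apply (proj2 sq_branch). split; [apply P1; lra|apply P2; lra]. }
  pose proof (cder_mult _ _ _ _ _ Ha Hb) as H4.
  apply cder_C_derive in H3. apply cder_C_derive in H4. rewrite H4 in H3; clear H4.
  pose proof (sq_neq0 (a z) (b z) Ia Ib) as Hs.
  pose proof (proj2 sq_branch (a z) (b z) (conj Ia Ib)) as Hq.
  pose proof (Im_pos_neq0 _ Ia); pose proof (Im_pos_neq0 _ Ib).
  assert (E : a' * b z + a z * b' = a z * b z * (a' / a z + b' / b z)) by (field; split; assumption).
  rewrite E, <- Hq in H3.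
  set (q := sq (a z, b z)) in H3, Hs, Hq |- *; clearbody q.
  transitivity ((l (RtoC 1) * q + q * l (RtoC 1)) / (2 * q)).
  - field; exact Hs.
  - rewrite <- H3. field. repeat split; trivial.
Qed.

Notation G e := (pairing hbar T e).

(** The times tau_j are a and b, and w_j their inverses: the first summand comes
    from the square root ([sq_cder]), the other two from the widths w_j of the
    Gaussian, and w_j' = - tau_j' w_j^2 gives the sign. *)
Lemma amplitude_cder (a b : C -> C) z a' b' t1 t2 :
  cder a z a' -> cder b z b' -> (Im (a z) < 0)%R -> (Im (b z) < 0)%R ->
  cder (fun y => sq (/ a y, / b y) * (RtoC hbar * G unit_expr (t1, / a y, t2, / b y))) z
   (let w1 := / a z in let w2 := / b z in
    - (sq (w1, w2) * RtoC hbar * ((a' * w1 + b' * w2) / 2 * G unit_expr (t1, w1, t2, w2)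
      + a' * (w1 * w1) * G (gauss_diff hbar W1 unit_expr) (t1, w1, t2, w2)
      + b' * (w2 * w2) * G (gauss_diff hbar W2 unit_expr) (t1, w1, t2, w2)))).
Proof.
  intros Ha Hb Ia Ib.
  pose proof (Im_neg_neq0 _ Ia) as Na; pose proof (Im_neg_neq0 _ Ib) as Nb.
  pose proof (cder_comp _ _ _ _ _ Ha (Cinv_cder _ Na)) as Ha'.
  pose proof (cder_comp _ _ _ _ _ Hb (Cinv_cder _ Nb)) as Hb'.
  pose proof (Im_Cinv_pos _ Ia) as Pa; pose proof (Im_Cinv_pos _ Ib) as Pb.
  eapply cder_eq.
  - apply cder_mult; [exact (sq_cder _ _ z _ _ Ha' Hb' Pa Pb)|].
    apply cder_mult; [apply cder_const|].
    exact (pairing_cder unit_expr _ _ _ _ z _ _ _ _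
      (cder_const t1 z) Ha' (cder_const t2 z) Hb' Pa Pb).
  - cbv beta zeta. simpl paramsum.
    set (g0 := G unit_expr _). set (g1 := G (gauss_diff hbar W1 unit_expr) _). set (g2 := G (gauss_diff hbar W2 unit_expr) _).
    set (g3 := G _ _). set (g4 := G _ _).
    set (q := sq _). clearbody q g0 g1 g2 g3 g4. field. split; assumption.
Qed.

(** * Reduction to the difference of the two times *)

(** The candidate f3 in coordinates s = 1/w1 - 1/w2 and m = (1/w1 + 1/w2)/2, still
    depending on m.  The exponential divides out the factor
    exp(k^2 (1/w1 + 1/w2) / (8 pi i hbar)). *)
Definition wave (s m t1 t2 : C) : C :=
  Cexp (- (RtoC (k ^ 2) * (m + m) / (8 * RtoC PI * Ci * RtoC hbar))) *
  (sq (/ (m + half * s), / (m - half * s)) *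
   (RtoC hbar * G unit_expr (t1, / (m + half * s), t2, / (m - half * s)))).

Lemma eight_alpha : 8 * RtoC PI * Ci * RtoC hbar = 8 * alpha hbar.
Proof. unfold alpha; rewrite RtoC_mult; ring. Qed.

Lemma alpha_neq0 : alpha hbar <> 0.
Proof.
  unfold alpha; intros E. injection E; intros.
  pose proof PI_RGT_0. assert (0 < PI * hbar)%R by now apply Rmult_lt_0_compat. lra.
Qed.

(** The Helmholtz equation with the t-derivatives replaced by w-derivatives. *)
Lemma helmholtz_reduced (t1 w1 t2 w2 : C) : (0 < Im w1)%R -> (0 < Im w2)%R ->
  4 * alpha hbar * (w1 * w1) * G (gauss_diff hbar W1 unit_expr) (t1, w1, t2, w2)
  + 4 * alpha hbar * (w2 * w2) * G (gauss_diff hbar W2 unit_expr) (t1, w1, t2, w2)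
  = - (2 * alpha hbar * (w1 + w2) + RtoC (k ^ 2)) * G unit_expr (t1, w1, t2, w2).
Proof.
  intros H1 H2.
  pose proof (pairing_helmholtz t1 w1 t2 w2 H1 H2) as H.
  rewrite (pairing_heat1 t1 w1 t2 w2 H1 H2) in H.
  rewrite (pairing_heat2 t1 w1 t2 w2 H1 H2) in H.
  match type of H with ?l = _ =>
    transitivity (l - (2 * alpha hbar * (w1 + w2) + RtoC (k ^ 2)) * G unit_expr (t1, w1, t2, w2)) end;
    [ring|rewrite H; ring].
Qed.

(** Moving both times 1/w1 and 1/w2 by the same amount acts through the Laplacian
    in (t1, t2), on which the Helmholtz equation fixes the value -k^2; the
    exponential factor compensates exactly. *)
Lemma wave_cder_m (s m t1 t2 : C) : below s m -> cder (fun m => wave s m t1 t2) m 0.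
Proof.
  intros [I1 I2].
  assert (Ha : cder (fun m => m + half * s) m 1).
  { eapply cder_eq; [apply cder_plus; [apply cder_id|apply cder_const]|ring]. }
  assert (Hb : cder (fun m => m - half * s) m 1).
  { eapply cder_eq; [apply cder_plus; [apply cder_id|apply cder_const]|ring]. }
  assert (He : cder (fun m => - (RtoC (k ^ 2) * (m + m) / (8 * RtoC PI * Ci * RtoC hbar))) m
      (- (RtoC (k ^ 2) / (4 * alpha hbar)))).
  { apply (cder_ext (fun m => - (RtoC (k ^ 2) / (8 * alpha hbar)) * (m + m))).
    - intros y. rewrite eight_alpha. unfold Cdiv; ring.
    - eapply cder_eq; [apply cder_mult; [apply cder_const|apply cder_plus; apply cder_id]|].
      cbv beta; field. apply alpha_neq0. }
  unfold wave. eapply cder_eq.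
  - apply cder_mult; [exact (cder_comp _ _ _ _ _ He (Cexp_cder _))|].
    exact (amplitude_cder _ _ m _ _ t1 t2 Ha Hb I1 I2).
  - cbv beta zeta.
    pose proof (helmholtz_reduced t1 (/ (m + half * s)) t2 (/ (m - half * s))
       (Im_Cinv_pos _ I1) (Im_Cinv_pos _ I2)) as H.
    pose proof alpha_neq0 as Hal.
    set (w1 := / (m + half * s)) in *. set (w2 := / (m - half * s)) in *.
    set (g0 := G unit_expr _) in *. set (g1 := G (gauss_diff hbar W1 unit_expr) _) in *.
    set (g2 := G (gauss_diff hbar W2 unit_expr) _) in *. set (q := sq _). set (E := Cexp _).
    set (al := alpha hbar) in *. clearbody al q E g0 g1 g2 w1 w2. clear - H Hal.
    transitivity (- (E * q * RtoC hbar / (4 * al)) *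
       (4 * al * (w1 * w1) * g1 + 4 * al * (w2 * w2) * g2
         + (2 * al * (w1 + w2) + RtoC (k ^ 2)) * g0)).
    + field. exact Hal.
    + rewrite H. field. exact Hal.
Qed.

(** For fixed s the admissible m form a convex set, so a vanishing derivative
    gives constancy. *)
Lemma wave_indep s m m' t1 t2 : below s m -> below s m' -> wave s m t1 t2 = wave s m' t1 t2.
Proof.
  intros [A B] [A' B'].
  apply (cder_zero_segment (fun m => wave s m t1 t2)).
  intros r Hr; apply wave_cder_m. assert (K : forall x y : R, (x < 0 -> y < 0 -> (1 - r) * x + r * y < 0)%R).
  { intros x y Hx Hy; destruct (Req_dec r 0) as [->|]; nra. }
  pose proof (K _ _ A A') as K1; pose proof (K _ _ B B') as K2.
  split; [refine (Rle_lt_trans _ _ _ (Req_le _ _ _) K1)|refine (Rle_lt_trans _ _ _ (Req_le _ _ _) K2)];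
    unfold Im, Re; simpl; ring.
Qed.

Definition prefactor (s m : C) : C :=
  Cexp (- (RtoC (k ^ 2) * (m + m) / (8 * RtoC PI * Ci * RtoC hbar))) *
  sq (/ (m + half * s), / (m - half * s)) * RtoC hbar.

Lemma wave_cder_s (s m t1 t2 : C) : below s m ->
  cder (fun s => wave s m t1 t2) s
   (let w1 := / (m + half * s) in let w2 := / (m - half * s) in
    - (prefactor s m * half * ((w1 - w2) / 2 * G unit_expr (t1, w1, t2, w2)
      + (w1 * w1) * G (gauss_diff hbar W1 unit_expr) (t1, w1, t2, w2)
      - (w2 * w2) * G (gauss_diff hbar W2 unit_expr) (t1, w1, t2, w2)))).
Proof.
  intros [I1 I2].
  assert (Ha : cder (fun s => m + half * s) s half).
  { eapply cder_eq; [apply cder_plus; [apply cder_const|apply cder_mult; [apply cder_const|apply cder_id]]|].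
    cbv beta; ring. }
  assert (Hb : cder (fun s => m - half * s) s (- half)).
  { apply (cder_ext (fun s => m + (- half) * s)); [intros; ring|].
    eapply cder_eq; [apply cder_plus; [apply cder_const|apply cder_mult; [apply cder_const|apply cder_id]]|].
    cbv beta; ring. }
  unfold wave. eapply cder_eq.
  - apply cder_mult; [apply cder_const|].
    exact (amplitude_cder _ _ s _ _ t1 t2 Ha Hb I1 I2).
  - unfold prefactor; cbv beta zeta.
    set (w1 := / (m + half * s)). set (w2 := / (m - half * s)).
    set (g0 := G unit_expr _). set (g1 := G (gauss_diff hbar W1 unit_expr) _).
    set (g2 := G (gauss_diff hbar W2 unit_expr) _). set (q := sq _). set (E := Cexp _).
    unfold Cdiv; ring.
Qed.

Lemma pairing_cder_t1 e (t1 w1 t2 w2 : C) : (0 < Im w1)%R -> (0 < Im w2)%R ->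
  cder (fun t => G e (t, w1, t2, w2)) t1 (G (gauss_diff hbar T1 e) (t1, w1, t2, w2)).
Proof.
  intros H1 H2. eapply cder_eq.
  - exact (pairing_cder e _ _ _ _ t1 _ _ _ _
      (cder_id t1) (cder_const w1 t1) (cder_const t2 t1) (cder_const w2 t1) H1 H2).
  - simpl; ring.
Qed.

Lemma pairing_cder_t2 e (t1 w1 t2 w2 : C) : (0 < Im w1)%R -> (0 < Im w2)%R ->
  cder (fun t => G e (t1, w1, t, w2)) t2 (G (gauss_diff hbar T2 e) (t1, w1, t2, w2)).
Proof.
  intros H1 H2. eapply cder_eq.
  - exact (pairing_cder e _ _ _ _ t2 _ _ _ _
      (cder_const t1 t2) (cder_const w1 t2) (cder_id t2) (cder_const w2 t2) H1 H2).
  - simpl; ring.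
Qed.

(** * The functions f3 and f4 *)

(** Any s in C is a difference of two points of the lower half-plane, so f3 is
    entire: the choice m = -i(|s| + 1) is admissible, and any other admissible
    m gives the same value ([wave_indep]). *)
Definition meta_f3 (p : C3) : C :=
  let '(s, t1, t2) := p in wave s (base_point (Cmod s + 1)) t1 t2.

Lemma meta_f3_eq (s m t1 t2 : C) : below s m -> meta_f3 (s, t1, t2) = wave s m t1 t2.
Proof.
  intros H; simpl; apply wave_indep; [|exact H].
  apply below_base_point; lra.
Qed.

(** The derivative may be computed with m frozen, since an admissible m stays
    admissible for nearby s. *)
Lemma cd1_meta_f3 (s m t1 t2 : C) : below s m ->
  cd1 meta_f3 (s, t1, t2) =
   (let w1 := / (m + half * s) in let w2 := / (m - half * s) in
    - (prefactor s m * half * ((w1 - w2) / 2 * G unit_expr (t1, w1, t2, w2)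
      + (w1 * w1) * G (gauss_diff hbar W1 unit_expr) (t1, w1, t2, w2)
      - (w2 * w2) * G (gauss_diff hbar W2 unit_expr) (t1, w1, t2, w2)))).
Proof.
  intros Hm; unfold cd1. apply cder_C_derive.
  assert (Ha : cder (fun s => - (m + half * s)) s (- half)).
  { apply (cder_ext (fun s => - m + (- half) * s)); [intros; ring|].
    eapply cder_eq; [apply cder_plus; [apply cder_const|apply cder_mult; [apply cder_const|apply cder_id]]|].
    cbv beta; ring. }
  assert (Hb : cder (fun s => - (m - half * s)) s half).
  { apply (cder_ext (fun s => - m + half * s)); [intros; ring|].
    eapply cder_eq; [apply cder_plus; [apply cder_const|apply cder_mult; [apply cder_const|apply cder_id]]|].
    cbv beta; ring. }
  destruct (Im_pos_near _ s _ Ha) as [r1 [Hr1 P1]].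
  { destruct Hm as [H _]; unfold Im, Re in *; simpl in *; lra. }
  destruct (Im_pos_near _ s _ Hb) as [r2 [Hr2 P2]].
  { destruct Hm as [_ H]; unfold Im, Re in *; simpl in *; lra. }
  refine (cder_ext_near _ _ _ _ (Rmin r1 r2) _ _ (wave_cder_s s m t1 t2 Hm)).
  - now apply Rmin_glb_lt.
  - intros h Hh. pose proof (Rmin_l r1 r2); pose proof (Rmin_r r1 r2).
    symmetry; apply meta_f3_eq. specialize (P1 h ltac:(lra)); specialize (P2 h ltac:(lra)).
    split; unfold Im, Re in *; simpl in *; lra.
Qed.

Lemma wave_prefactor (s m t1 t2 : C) :
  wave s m t1 t2 = prefactor s m * G unit_expr (t1, / (m + half * s), t2, / (m - half * s)).
Proof. unfold wave, prefactor; ring. Qed.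

Lemma cd22_meta_f3 (s m t1 t2 : C) : below s m ->
  cd2 (cd2 meta_f3) (s, t1, t2) = prefactor s m *
    G (gauss_diff hbar T1 (gauss_diff hbar T1 unit_expr)) (t1, / (m + half * s), t2, / (m - half * s)).
Proof.
  intros Hm. pose proof (Im_Cinv_pos _ (proj1 Hm)) as P1. pose proof (Im_Cinv_pos _ (proj2 Hm)) as P2.
  assert (D : forall e t, cder (fun t => prefactor s m * G e (t, / (m + half * s), t2, / (m - half * s))) t
     (prefactor s m * G (gauss_diff hbar T1 e) (t, / (m + half * s), t2, / (m - half * s)))).
  { intros e t; eapply cder_eq.
    - apply cder_mult; [apply cder_const|]. apply pairing_cder_t1; assumption.
    - cbv beta; ring. }
  unfold cd2. apply cder_C_derive.
  eapply cder_ext; [|apply (D (gauss_diff hbar T1 unit_expr))].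
  intros t; symmetry; apply cder_C_derive.
  eapply cder_ext; [|apply (D unit_expr)].
  intros t'; exact (eq_sym (eq_trans (meta_f3_eq s m t' t2 Hm) (wave_prefactor s m t' t2))).
Qed.

Lemma cd33_meta_f3 (s m t1 t2 : C) : below s m ->
  cd3 (cd3 meta_f3) (s, t1, t2) = prefactor s m *
    G (gauss_diff hbar T2 (gauss_diff hbar T2 unit_expr)) (t1, / (m + half * s), t2, / (m - half * s)).
Proof.
  intros Hm. pose proof (Im_Cinv_pos _ (proj1 Hm)) as P1. pose proof (Im_Cinv_pos _ (proj2 Hm)) as P2.
  assert (D : forall e t, cder (fun t => prefactor s m * G e (t1, / (m + half * s), t, / (m - half * s))) t
     (prefactor s m * G (gauss_diff hbar T2 e) (t1, / (m + half * s), t, / (m - half * s)))).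
  { intros e t; eapply cder_eq.
    - apply cder_mult; [apply cder_const|]. apply pairing_cder_t2; assumption.
    - cbv beta; ring. }
  unfold cd3. apply cder_C_derive.
  eapply cder_ext; [|apply (D (gauss_diff hbar T2 unit_expr))].
  intros t; symmetry; apply cder_C_derive.
  eapply cder_ext; [|apply (D unit_expr)].
  intros t'; exact (eq_sym (eq_trans (meta_f3_eq s m t1 t' Hm) (wave_prefactor s m t1 t'))).
Qed.

Lemma four_alpha : 4 * RtoC PI * Ci * RtoC hbar = 4 * alpha hbar.
Proof. unfold alpha; rewrite RtoC_mult; ring. Qed.

(** Each equation combines the two heat equations with one half of the Helmholtz
    equation. *)
Lemma meta_f3_pde_at (s t1 t2 : C) : let p : C3 := (s, t1, t2) in
  4 * RtoC PI * Ci * RtoC hbar * cd1 meta_f3 p + cd2 (cd2 meta_f3) p + / 2 * RtoC (k ^ 2) * meta_f3 p = 0 /\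
  4 * RtoC PI * Ci * RtoC hbar * cd1 meta_f3 p - cd3 (cd3 meta_f3) p - / 2 * RtoC (k ^ 2) * meta_f3 p = 0.
Proof.
  cbv zeta.
  assert (Hm : below s (base_point (Cmod s + 1))) by (apply below_base_point; lra).
  set (m := base_point (Cmod s + 1)) in *.
  rewrite (cd1_meta_f3 s m t1 t2 Hm), (cd22_meta_f3 s m t1 t2 Hm), (cd33_meta_f3 s m t1 t2 Hm),
    (meta_f3_eq s m t1 t2 Hm), wave_prefactor, four_alpha.
  pose proof (Im_Cinv_pos _ (proj1 Hm)) as P1. pose proof (Im_Cinv_pos _ (proj2 Hm)) as P2.
  cbv zeta.
  set (w1 := / (m + half * s)) in *. set (w2 := / (m - half * s)) in *.
  rewrite (pairing_heat1 t1 w1 t2 w2 P1 P2).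
  rewrite (pairing_heat2 t1 w1 t2 w2 P1 P2).
  pose proof (helmholtz_reduced t1 w1 t2 w2 P1 P2) as H.
  set (g0 := G unit_expr _) in *. set (g1 := G (gauss_diff hbar W1 unit_expr) _) in *.
  set (g2 := G (gauss_diff hbar W2 unit_expr) _) in *. set (P := prefactor s m).
  set (al := alpha hbar) in *. clearbody al P g0 g1 g2 w1 w2. clear - H. rewrite half_eq.
  set (S := 4 * al * (w1 * w1) * g1 + 4 * al * (w2 * w2) * g2) in H.
  split.
  - transitivity (P * / 2 * (S + (2 * al * (w1 + w2) + RtoC (k ^ 2)) * g0)).
    + unfold S; field.
    + rewrite H; ring.
  - transitivity (- (P * / 2 * (S + (2 * al * (w1 + w2) + RtoC (k ^ 2)) * g0))).
    + unfold S; field.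
    + rewrite H; ring.
Qed.

Lemma meta_f3_pde (p : C3) :
  4 * RtoC PI * Ci * RtoC hbar * cd1 meta_f3 p + cd2 (cd2 meta_f3) p + / 2 * RtoC (k ^ 2) * meta_f3 p = 0 /\
  4 * RtoC PI * Ci * RtoC hbar * cd1 meta_f3 p - cd3 (cd3 meta_f3) p - / 2 * RtoC (k ^ 2) * meta_f3 p = 0.
Proof. destruct p as [[s t1] t2]; apply meta_f3_pde_at. Qed.

Lemma wave_cdiff (s m t1 t2 : C) : below s m ->
  exists l, cdiff (U := C3) (fun p => let '(s, t1, t2) := p in wave s m t1 t2) (s, t1, t2) l.
Proof.
  intros Hm.
  assert (Ds : cdiff (U := C3) (fun p => fst (fst p)) (s, t1, t2) (fun p => fst (fst p))).
  { apply filterdiff_linear.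
    apply (is_linear_comp (U := C3) (V := C2) (W := C_NormedModule) (fun p => fst p) (fun p => fst p));
      apply is_linear_fst. }
  assert (Dt1 : cdiff (U := C3) (fun p => snd (fst p)) (s, t1, t2) (fun p => snd (fst p))).
  { apply filterdiff_linear.
    apply (is_linear_comp (U := C3) (V := C2) (W := C_NormedModule) (fun p => fst p) (fun p => snd p));
      [apply is_linear_fst|apply is_linear_snd]. }
  assert (Dt2 : cdiff (U := C3) (fun p => snd p) (s, t1, t2) (fun p => snd p)).
  { apply filterdiff_linear, is_linear_snd. }
  pose proof (cdiff_plus _ _ _ _ _ (cdiff_const m ((s, t1, t2) : C3))
     (cdiff_mult _ _ _ _ _ (cdiff_const half ((s, t1, t2) : C3)) Ds)) as Da.
  pose proof (cdiff_plus _ _ _ _ _ (cdiff_const m ((s, t1, t2) : C3))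
     (cdiff_mult _ _ _ _ _ (cdiff_const (- half) ((s, t1, t2) : C3)) Ds)) as Db.
  assert (I1 : (Im (m + half * s) < 0)%R) by apply Hm.
  assert (I2 : (Im (m + - half * s) < 0)%R).
  { replace (m + - half * s) with (m - half * s) by ring. apply Hm. }
  pose proof (cdiff_inv _ _ _ Da (Im_neg_neq0 _ I1)) as Da'.
  pose proof (cdiff_inv _ _ _ Db (Im_neg_neq0 _ I2)) as Db'.
  destruct (sq_cdiff_comp _ _ _ _ _ Da' Db' (Im_Cinv_pos _ I1) (Im_Cinv_pos _ I2)) as [l Hl].
  pose proof (pairing_cdiff_comp unit_expr _ _ _ _ _ _ _ _ _ Dt1 Da' Dt2 Db'
    (Im_Cinv_pos _ I1) (Im_Cinv_pos _ I2)) as Hg.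
  pose proof (cdiff_mult _ _ _ _ _
    (cdiff_const (Cexp (- (RtoC (k ^ 2) * (m + m) / (8 * RtoC PI * Ci * RtoC hbar)))) ((s, t1, t2) : C3))
    (cdiff_mult _ _ _ _ _ Hl (cdiff_mult _ _ _ _ _ (cdiff_const (RtoC hbar) ((s, t1, t2) : C3)) Hg))) as H.
  eexists; eapply filterdiff_ext; [|exact H].
  intros [[s' t1'] t2']. unfold wave. simpl fst; simpl snd.
  replace (m + - half * s') with (m - half * s') by ring. reflexivity.
Qed.

Lemma meta_f3_holomorphic : holomorphic_on (fun _ : C3 => True) meta_f3.
Proof.
  intros [[s t1] t2] _.
  destruct (wave_cdiff s (base_point (Cmod s + 1)) t1 t2) as [l0 _]; [apply below_base_point; lra|].
  destruct (wave_cdiff s (base_point (Cmod s + 2)) t1 t2) as [l Hl]; [apply below_base_point; lra|].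
  (* on the unit ball around s the base point for |s| + 2 is admissible *)
  exists l. refine (filterdiff_ext_locally _ _ _ _ _ Hl).
  apply (locally_le_locally_norm (V := C3)).
  exists (mkposreal 1 Rlt_0_1). intros [[s' t1'] t2'] Hy.
  change (norm (minus ((s', t1', t2') : C3) ((s, t1, t2) : C3)) < 1)%R in Hy.
  set (d := minus ((s', t1', t2') : C3) ((s, t1, t2) : C3)) in Hy.
  pose proof (norm_fst_le (U := C2) (V := C_NormedModule) d) as N2.
  pose proof (norm_fst_le (U := C_NormedModule) (V := C_NormedModule) (fst d)) as N1.
  assert (Hs : (Cmod (s' - s) < 1)%R).
  { apply (Rle_lt_trans _ _ _ N1). exact (Rle_lt_trans _ _ _ N2 Hy). }
  symmetry; apply meta_f3_eq, below_base_point.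
  replace s' with (s + (s' - s)) by ring.
  eapply Rle_lt_trans; [apply Cmod_triangle|]. lra.
Qed.

Definition meta_f4 (p : C4) : C :=
  let '(z1, w1, z2, w2) := p in RtoC hbar * G unit_expr (z1 / w1, w1, z2 / w2, w2).

Lemma meta_f4_holomorphic : holomorphic_on upper4 meta_f4.
Proof.
  intros [[[z1 w1] z2] w2] [I1 I2].
  set (p := (z1, w1, z2, w2) : C4).
  assert (L3 : is_linear (K := C_AbsRing) (U := C4) (V := C3) (fun p => fst p)) by apply is_linear_fst.
  assert (L2 : is_linear (K := C_AbsRing) (U := C4) (V := C2) (fun p => fst (fst p))).
  { apply (is_linear_comp (U := C4) (V := C3) (W := C2) (fun p => fst p) (fun p => fst p));
      [exact L3|apply is_linear_fst]. }
  assert (D1 : cdiff (U := C4) (fun p => fst (fst (fst p))) p (fun p => fst (fst (fst p)))).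
  { apply filterdiff_linear.
    apply (is_linear_comp (U := C4) (V := C2) (W := C_NormedModule) (fun p => fst (fst p)) (fun p => fst p));
      [exact L2|apply is_linear_fst]. }
  assert (D2 : cdiff (U := C4) (fun p => snd (fst (fst p))) p (fun p => snd (fst (fst p)))).
  { apply filterdiff_linear.
    apply (is_linear_comp (U := C4) (V := C2) (W := C_NormedModule) (fun p => fst (fst p)) (fun p => snd p));
      [exact L2|apply is_linear_snd]. }
  assert (D3 : cdiff (U := C4) (fun p => snd (fst p)) p (fun p => snd (fst p))).
  { apply filterdiff_linear.
    apply (is_linear_comp (U := C4) (V := C3) (W := C_NormedModule) (fun p => fst p) (fun p => snd p));
      [exact L3|apply is_linear_snd]. }
  assert (D4 : cdiff (U := C4) (fun p => snd p) p (fun p => snd p)).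
  { apply filterdiff_linear, is_linear_snd. }
  pose proof (cdiff_mult _ _ _ _ _ D1 (cdiff_inv _ _ _ D2 (Im_pos_neq0 _ I1))) as E1.
  pose proof (cdiff_mult _ _ _ _ _ D3 (cdiff_inv _ _ _ D4 (Im_pos_neq0 _ I2))) as E3.
  pose proof (pairing_cdiff_comp unit_expr _ _ _ _ _ _ _ _ _ E1 D2 E3 D4 I1 I2) as Hg.
  pose proof (cdiff_mult _ _ _ _ _ (cdiff_const (RtoC hbar) p) Hg) as H.
  eexists; eapply filterdiff_ext; [|exact H].
  intros [[[z1' w1'] z2'] w2']; reflexivity.
Qed.

(** With m = (1/w1 + 1/w2)/2 the two times are 1/w1 and 1/w2 and the prefactors
    cancel. *)
Lemma meta_f4_f3 (z1 w1 z2 w2 : C) : (0 < Im w1)%R -> (0 < Im w2)%R ->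
  meta_f4 (z1, w1, z2, w2) =
    Cexp (RtoC (k ^ 2) * (/ w1 + / w2) / (8 * RtoC PI * Ci * RtoC hbar))
    / sq (w1, w2) * meta_f3 (/ w1 - / w2, z1 / w1, z2 / w2).
Proof.
  intros I1 I2.
  pose proof (Im_pos_neq0 _ I1) as N1. pose proof (Im_pos_neq0 _ I2) as N2.
  set (m := half * (/ w1 + / w2)).
  assert (E1 : m + half * (/ w1 - / w2) = / w1) by (unfold m; rewrite half_eq; field; tauto).
  assert (E2 : m - half * (/ w1 - / w2) = / w2) by (unfold m; rewrite half_eq; field; tauto).
  assert (E3 : m + m = / w1 + / w2) by (unfold m; rewrite half_eq; field; tauto).
  rewrite (meta_f3_eq _ m).
  2: { unfold below; rewrite E1, E2; split; now apply Im_Cinv_neg. }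
  unfold wave. rewrite E1, E2, E3.
  replace (/ / w1) with w1 by (field; assumption).
  replace (/ / w2) with w2 by (field; assumption).
  set (X := RtoC (k ^ 2) * (/ w1 + / w2) / (8 * RtoC PI * Ci * RtoC hbar)).
  assert (HE : Cexp X * Cexp (- X) = 1).
  { rewrite <- Cexp_plus. replace (X + - X) with (RtoC 0) by ring.
    unfold Cexp; simpl. rewrite exp_0, cos_0, sin_0. apply C_eq; simpl; ring. }
  pose proof (sq_neq0 w1 w2 I1 I2) as Hs.
  unfold meta_f4. set (g := G unit_expr _).
  transitivity (Cexp X * Cexp (- X) * (RtoC hbar * g)); [rewrite HE; ring|].
  field. exact Hs.
Qed.

(** Completing the square in u: the kernel is a Gaussian centred at z/w times
    exp(-pi i hbar x^2 / w), the weight in [calG]. *)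
Lemma meta_kernel_eq x y b r u : (0 < r)%R ->
  let w := RtoC b + Ci * RtoC (r ^ 2) in
  let z := RtoC x + w * RtoC y in
  meta_kernel hbar x y b r u =
  Cexp (- (RtoC PI * Ci * RtoC hbar) * (RtoC (x ^ 2) / w)) *
  Cexp (alpha hbar * (w * ((RtoC u - z / w) * (RtoC u - z / w)))).
Proof.
  intros Hr w z.
  assert (Hw : w <> 0).
  { apply Im_pos_neq0. unfold w, Im, Re; simpl. nra. }
  assert (Hc : RtoC (r ^ 2) - Ci * RtoC b = - (Ci * w)).
  { unfold w. apply C_eq; unfold Im, Re; simpl; ring. }
  unfold meta_kernel. rewrite Hc, <- Cexp_plus. f_equal. unfold z, alpha.
  rewrite !RtoC_mult. replace (RtoC ((u - y) ^ 2)) with ((RtoC u - RtoC y) * (RtoC u - RtoC y)).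
  2: { rewrite <- RtoC_minus, <- RtoC_mult. f_equal; ring. }
  replace (RtoC (x ^ 2)) with (RtoC x * RtoC x) by (rewrite <- RtoC_mult; f_equal; ring).
  rewrite RtoC_minus. clearbody w. field. exact Hw.
Qed.

Lemma metamorphism_calG x1 y1 b1 r1 x2 y2 b2 r2 : (0 < r1)%R -> (0 < r2)%R ->
  metamorphism hbar T x1 y1 b1 r1 x2 y2 b2 r2 = calG hbar meta_f4 x1 y1 b1 r1 x2 y2 b2 r2.
Proof.
  intros H1 H2. unfold metamorphism, calG, meta_f4.
  set (w1 := RtoC b1 + Ci * RtoC (r1 ^ 2)). set (w2 := RtoC b2 + Ci * RtoC (r2 ^ 2)).
  set (z1 := RtoC x1 + w1 * RtoC y1). set (z2 := RtoC x2 + w2 * RtoC y2).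
  set (c1 := - (RtoC PI * Ci * RtoC hbar) * (RtoC (x1 ^ 2) / w1)).
  set (c2 := - (RtoC PI * Ci * RtoC hbar) * (RtoC (x2 ^ 2) / w2)).
  set (p := (z1 / w1, w1, z2 / w2, w2) : C4).
  assert (Hp : upper4 p).
  { split; unfold w1, w2, Im, Re; simpl; nra. }
  replace (T _) with (Cexp c1 * Cexp c2 * G unit_expr p).
  - replace (- (RtoC PI * Ci * RtoC hbar) * (RtoC (x1 ^ 2) / w1 + RtoC (x2 ^ 2) / w2)) with (c1 + c2)
      by (unfold c1, c2; ring).
    rewrite Cexp_plus, RtoC_mult. unfold p; set (g := G unit_expr _); ring.
  - change (G unit_expr p) with (T (gauss_jet hbar unit_expr p O O)).
    rewrite <- tempered_scal; [|exact T_tempered|now apply gauss_jet_schwartz].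
    f_equal. apply functional_extensionality; intros u1; apply functional_extensionality; intros u2.
    rewrite !meta_kernel_eq by assumption. cbv zeta.
    fold w1 w2. fold z1 z2. fold c1 c2.
    unfold jet_scal, gauss_jet, gauss_val. cbn [gauss_mix gauss_diffn poly_eval unit_expr env p phase PSqr PSub].
    replace (Cexp (alpha hbar * (w1 * _ + w2 * _))) with
      (Cexp (alpha hbar * (w1 * ((RtoC u1 - z1 / w1) * (RtoC u1 - z1 / w1)))) *
       Cexp (alpha hbar * (w2 * ((RtoC u2 - z2 / w2) * (RtoC u2 - z2 / w2))))).
    + simpl. ring.
    + rewrite <- Cexp_plus. f_equal. ring.
Qed.

End Metamorphism.

Theorem theorem7 (hbar : R) (hbar_gt0 : (0 < hbar)%R)
    (sq : C2 -> C) (sq_branch : sqrt_branch sq)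
    (k : R) (f : (R -> R -> C) -> C)
    (f_tempered : tempered f) (f_helmholtz : helmholtz k f) :
  exists (f4 : C4 -> C) (f3 : C3 -> C),
    holomorphic_on upper4 f4 /\
    holomorphic_on (fun _ : C3 => True) f3 /\
    (forall x1 y1 b1 r1 x2 y2 b2 r2 : R, (0 < r1)%R -> (0 < r2)%R ->
       metamorphism hbar f x1 y1 b1 r1 x2 y2 b2 r2 =
       calG hbar f4 x1 y1 b1 r1 x2 y2 b2 r2) /\
    (forall z1 w1 z2 w2 : C, (0 < Im w1)%R -> (0 < Im w2)%R ->
       f4 (z1, w1, z2, w2) =
       Cexp (RtoC (k ^ 2) * (/ w1 + / w2) / (8 * RtoC PI * Ci * RtoC hbar))
       / sq (w1, w2) * f3 (/ w1 - / w2, z1 / w1, z2 / w2)) /\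
    (forall p : C3,
       4 * RtoC PI * Ci * RtoC hbar * cd1 f3 p + cd2 (cd2 f3) p
       + / 2 * RtoC (k ^ 2) * f3 p = 0) /\
    (forall p : C3,
       4 * RtoC PI * Ci * RtoC hbar * cd1 f3 p - cd3 (cd3 f3) p
       - / 2 * RtoC (k ^ 2) * f3 p = 0).
Proof.
  exists (meta_f4 hbar f), (meta_f3 hbar f k sq).
  split; [now apply meta_f4_holomorphic|].
  split; [now apply meta_f3_holomorphic|].
  split; [now apply metamorphism_calG|].
  split; [now apply meta_f4_f3|].
  split; intros p; now apply meta_f3_pde.
Qed.
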